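(* Let $\mathcal{T}$ be the (deterministic) binary tree with depth $3$ and assume that the outcomes $(R(x))_{x\in\mathcal{L}}$ on its eight leaves are i.i.d. and Bernoulli$(1/2)$-distributed. Then the branching Assumption (see context) is satisfied. Apply the step-by-step algorithm described in the context, with the functions $m$ and $s$ defined in the context for this model, producing random leaves $x_1,x_2,\dots$; set $\mathbf{x}_n=\{x_1,\dots,x_n\}$, $\mathcal{F}_n=\sigma(B_{\mathbf{x}_n},\mathcal{D}_{\mathbf{x}_n},(R(x))_{x\in\mathbf{x}_n})$ and $R_n(r)=\mathbb{E}[R(r)\mid\mathcal{F}_n]$. There is another admissible algorithm, producing random leaves $\tilde{x}_1,\tilde{x}_2,\dots$, such that, with $\tilde{\mathbf{x}}_n=\{\tilde{x}_1,\dots,\tilde{x}_n\}$, $\tilde{\mathcal{F}}_n=\sigma(B_{\tilde{\mathbf{x}}_n},\mathcal{D}_{\tilde{\mathbf{x}}_n},(R(x))_{x\in\tilde{\mathbf{x}}_n})$ and $\tilde{R}_n(r)=\mathbb{E}[R(r)\mid\tilde{\mathcal{F}}_n]$, $$\mathbb{E}[(\tilde{R}_2(r)-R(r))^2]>\mathbb{E}[(R_2(r)-R(r))^2]\quad\text{but}\quad \mathbb{E}[(\tilde{R}_3(r)-R(r))^2]<\mathbb{E}[(R_3(r)-R(r))^2].$$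
   Context: **Trees.** $\mathbb{T}$ is the set of finite words over $\mathbb{N}_*=\{1,2,\dots\}$, seen as the complete ordered tree with root $r$ the empty word. $|x|$ is the length (depth) of $x$. The father $f(x)$ of $x\ne r$ is obtained by deleting the last letter of $x$. $\mathbb{C}_x=\{y:f(y)=x\}$; $\mathbb{T}_x$ is the set consisting of $x$ and all its descendants; $\mathbb{H}_x=\mathbb{C}_{f(x)}\setminus\{x\}$ (brothers of $x$) for $x\neq r$ and $\mathbb{H}_r=\emptyset$. For $y\in\mathbb{T}_x$, $B_{xy}=\{z\in\mathbb{T}_x: y\in\mathbb{T}_z\}$ is the branch from $x$ to $y$. $\mathbb{K}_x=\bigcup_{y\in B_{rx}}(\{y\}\cup\mathbb{H}_y)$. For $\mathbf{x}\subset\mathbb{T}$, $B_{\mathbf{x}}=\bigcup_{x\in\mathbf{x}}B_{rx}$ and $\mathbb{D}_{\mathbf{x}}=(\bigcup_{x\in B_{\mathbf{x}}}\mathbb{H}_x)\setminus B_{\mathbf{x}}$. $\mathcal{S}_f$ is the set of finite subtrees of $\mathbb{T}$ with root $r$ (finite $T\ni r$ with $B_{rx}\subset T$ for all $x\in T$). For $T\in\mathcal{S}_f$, $L_T=\{x\in T:T\cap\mathbb{T}_x=\{x\}\}$ is its set of leaves. The binary tree with depth $3$ is the set of words of length at most $3$ over $\{1,2\}$; its leaves are the words of length $3$. **Game.** For a game tree $\mathcal{T}\in\mathcal{S}_f$ with leaves $\mathcal{L}=L_{\mathcal{T}}$, write $\mathcal{T}_x=\mathcal{T}\cap\mathbb{T}_x$,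 $\mathcal{C}_x=\mathcal{T}\cap\mathbb{C}_x$, $\mathcal{H}_x=\mathcal{T}\cap\mathbb{H}_x$, $\mathcal{K}_x=\mathcal{T}\cap\mathbb{K}_x$ for $x\in\mathcal T$, and $\mathcal{D}_{\mathbf{x}}=\mathcal{T}\cap\mathbb{D}_{\mathbf{x}}$ for $\mathbf{x}\subset\mathcal{T}$. Set $t(x)=1$ if $|x|$ is even and $t(x)=0$ if $|x|$ is odd. The outcomes on $\mathcal L$ are extended to minimax values on $\mathcal{T}$ by backward induction: for $x\in\mathcal{T}\setminus\mathcal{L}$, $R(x)=\min_{y\in\mathcal{C}_x}R(y)$ if $t(x)=0$ and $R(x)=\max_{y\in\mathcal{C}_x}R(y)$ if $t(x)=1$. A *uniformly random match* starting from $x\in\mathcal{T}$ goes down from $x$, choosing at each step uniformly among the children in $\mathcal{T}$ of the current node, until a leaf of $\mathcal{T}$ (the resulting leaf) is reached. **Assumption (branching).** $\mathcal{T}$ is a random element of $\mathcal{S}_f$ and, conditionally on $\mathcal{T}$, $(R(x))_{x\in\mathcal{L}}$ are random outcomes in $\{0,1\}$. For $T\in\mathcal{S}_f$ put $A_T=\{T\subset\mathcal{T}\text{ and }\mathcal{D}_{L_T}=\emptyset\}$. For every $T\in\mathcal{S}_f$ with $\Pr(A_T)>0$, the family $\big((\mathcal{T}_x,(R(y))_{y\in\mathcal{L}\cap\mathcal{T}_x}),\,x\in L_T\big)$ is independent conditionally on $A_T$. **The functions $m$ and $s$.** For $T\in\mathcal{S}_f$ with $\Pr(A_T)>0$ and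 $z\in L_T$ (so $z\in\mathcal{T}$ on $A_T$): $m(T,z)=\Pr(R(z)=1\mid A_T)$; and, simulating a uniformly random match from $z$ with resulting leaf $y$, and setting $\mathcal{K}_{zy}=\mathcal{K}_y\cap\mathbb{T}_z$ and $\mathcal{G}=\sigma(y,\mathcal{K}_{zy},R(y))$, $s(T,z)=\mathbb{E}\big[\big(\Pr(R(z)=1\mid\mathcal{G}\vee\sigma(A_T))-m(T,z)\big)^2\mid A_T\big]$. **Admissible algorithm.** Step 1: simulate a uniformly random match from $r$, with resulting leaf $x_1$, and set $\mathbf{x}_1=\{x_1\}$. Step $n+1$: choose $z_n\in\mathcal{D}_{\mathbf{x}_n}\cup\mathbf{x}_n$ as $z_n=F(B_{\mathbf{x}_n},\mathcal{D}_{\mathbf{x}_n},(R(x))_{x\in\mathbf{x}_n},X_n)$, where $F$ is a deterministic measurable function and $X_n\sim\mathcal{U}([0,1])$ is independent of everything else. If $z_n\in\mathbf{x}_n$, set $x_{n+1}=z_n$ and $\mathbf{x}_{n+1}=\mathbf{x}_n$. If $z_n\in\mathcal{D}_{\mathbf{x}_n}$, simulate a uniformly random match from $z_n$, with resulting leaf $x_{n+1}$, and set $\mathbf{x}_{n+1}=\mathbf{x}_n\cup\{x_{n+1}\}$. **Step-by-step algorithm.** It is the admissible algorithm in which $z_n$ is chosen as follows. After $n$ steps, define by backward induction on $B_{\mathbf{x}_n}\cup\mathcal{D}_{\mathbf{x}_n}$: - if $x\in\mathbf{x}_n$: $R_n(x)=R(x)$ and $Z_n(x)=0$; - if $x\in\mathcal{D}_{\mathbf{x}_n}$: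 $R_n(x)=m(\mathcal{K}_x,x)$ and $Z_n(x)=s(\mathcal{K}_x,x)$; - if $x\in B_{\mathbf{x}_n}\setminus\mathbf{x}_n$: $R_n(x)=\prod_{y\in\mathcal{C}_x}R_n(y)$ if $t(x)=0$ and $R_n(x)=1-\prod_{y\in\mathcal{C}_x}(1-R_n(y))$ if $t(x)=1$; and $Z_n(x)=\max\{(U_n(y))^2Z_n(y):y\in\mathcal{C}_x\}$; - where, for $x\in(B_{\mathbf{x}_n}\cup\mathcal{D}_{\mathbf{x}_n})\setminus\{r\}$, $U_n(x)=\prod_{y\in\mathcal{H}_x}R_n(y)$ if $t(f(x))=0$ and $U_n(x)=\prod_{y\in\mathcal{H}_x}(1-R_n(y))$ if $t(f(x))=1$. Then put $z=r$ and, until $z\in\mathbf{x}_n\cup\mathcal{D}_{\mathbf{x}_n}$, replace $z$ by $\arg\max\{(U_n(y))^2Z_n(y):y\in\mathcal{C}_z\}$ (ties broken e.g. uniformly at random); $z_n$ is the final $z$. If at some point $R_n(r)\in\{0,1\}$ the algorithm may stop, in which case $\mathcal F_k=\mathcal F_n$ and $R_k(r)=R_n(r)$ for $k\ge n$. *)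

(* Defs.v *)
From HB Require Import structures.
From mathcomp Require Import all_boot all_order all_algebra.
From mathcomp Require Import finmap.
From mathcomp Require Import all_classical all_reals all_analysis.

Set Implicit Arguments.
Unset Strict Implicit.
Unset Printing Implicit Defensive.

Import Order.TTheory GRing.Theory Num.Theory.
Import numFieldNormedType.Exports.

Local Open Scope classical_set_scope.
Local Open Scope ring_scope.
Local Open Scope fmap_scope.
Local Open Scope fset_scope.

(** * Trees *)

(* Nodes of the complete tree.  The requirement that letters be positive is
   part of [subtree] below; every set of nodes that is used is a subset of
   some [subtree]. *)
Notation word := (seq nat).

Definition father (x : word) : word := take (size x).-1 x.

Definition child (x y : word) : bool := (y != [::]) && (father y == x).

(* [desc x y]: y belongs to T_x, i.e. x is a prefix of y. *)
Definition desc (x y : word) : bool := prefix x y.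

(* [brother x y]: y belongs to H_x. *)
Definition brother (x y : word) : bool :=
  (x != [::]) && child (father x) y && (y != x).

(* The branch B_{rx}, listed from the root to x. *)
Definition branch (x : word) : seq word :=
  [seq take k x | k <- iota 0 (size x).+1].

(* Membership in S_f. *)
Definition subtree (T : {fset word}) : Prop :=
  [/\ [::] \in T,
      forall x, x \in T -> {subset branch x <= T} &
      forall x, x \in T -> all (leq 1) x].

Definition subtree_at (T : {fset word}) (x : word) : {fset word} :=
  [fset y in T | desc x y].

Definition leaves (T : {fset word}) : {fset word} :=
  [fset x in T | subtree_at T x == [fset x]].

Definition children (T : {fset word}) (x : word) : {fset word} :=
  [fset y in T | child x y].

Definition brothers (T : {fset word}) (x : word) : {fset word} :=
  [fset y in T | brother x y].

(* T \cap K_x *)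
Definition Kset (T : {fset word}) (x : word) : {fset word} :=
  [fset w in T | has (fun y => (w == y) || brother y w) (branch x)].

(* B_X for a finite set X of nodes *)
Definition Bset (X : {fset word}) : {fset word} :=
  [fset w in flatten [seq branch x | x <- enum_fset X]].

(* T \cap D_X *)
Definition Dset (T X : {fset word}) : {fset word} :=
  [fset w in T | has (fun y => brother y w) (enum_fset (Bset X))
                 && (w \notin Bset X)].

Fixpoint words (a : seq nat) (n : nat) : seq word :=
  if n is k.+1 then [seq i :: w | i <- a, w <- words a k] else [:: [::]].

Definition binary_tree (n : nat) : {fset word} :=
  [fset w in flatten [seq words [:: 1; 2]%N k | k <- iota 0 n.+1]].

(** * Minimax values and random matches on a fixed game tree *)

(* t(x) = 1 *)
Definition max_node (x : word) : bool := ~~ odd (size x).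

(* Backward induction is written with a fuel k; as a chain of nodes of T has
   at most #|` T | elements, this amount of fuel is enough. *)
Fixpoint minimax_rec (T : {fset word}) (o : {fmap word -> bool}) (k : nat)
    (x : word) : bool :=
  if o.[? x] is Some b then b else
  if k is j.+1 then
    if max_node x then has (minimax_rec T o j) (enum_fset (children T x))
    else all (minimax_rec T o j) (enum_fset (children T x))
  else false.

Definition minimax (T : {fset word}) (o : {fmap word -> bool}) : word -> bool :=
  minimax_rec T o #|` T |.

(* Probability that a uniformly random match on T started at z ends at y. *)
Fixpoint match_prob_rec (R : realType) (T : {fset word}) (k : nat)
    (z y : word) : R :=
  if z \in leaves T then (z == y)%:R else
  if k is j.+1 then
    \sum_(c <- children T z)
      (#|` children T z |%:R)^-1 * match_prob_rec R T j c y
  else 0.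

Definition match_prob (R : realType) (T : {fset word}) (z y : word) : R :=
  match_prob_rec R T #|` T | z y.

(** * Conditioning *)

Section Conditioning.
Context (R : realType) (d : measure_display) (Omega : measurableType d).
Variable P : probability Omega R.

(* Conditional probability and expectation given an event A with P A > 0 *)
Definition cprob (E A : set Omega) : R := fine (P (E `&` A)%classic) / fine (P A).

Definition cexpect (X : Omega -> R) (A : set Omega) : R :=
  fine (\int[P]_(w in A) (X w)%:E) / fine (P A).

(* Mutual independence, conditionally on A, of the discrete random elements
   Y x, x \in I.  They take countably many values, so that every set of values
   is allowed. *)
Definition cond_indep (V : Type) (A : set Omega) (I : {fset word})
    (Y : word -> Omega -> V) : Prop :=
  forall (J : {fset word}) (E : word -> set V), {subset J <= I} ->
    cprob [set w | forall x, x \in J -> E x (Y x w)] A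
    = \prod_(x <- J) cprob [set w | E x (Y x w)] A.

(* sigma(Y) for Y with values in a countable set with its discrete
   sigma-algebra *)
Definition sigma_of (V : Type) (Y : Omega -> V) : set (set Omega) :=
  preimage_set_system setT Y setT.

Definition is_cond_exp (H : set (set Omega)) (X Z : Omega -> R) : Prop :=
  [/\ forall B, measurable B -> H (Z @^-1` B),
      P.-integrable setT (EFin \o Z) &
      forall A, H A -> (\int[P]_(w in A) (Z w)%:E = \int[P]_(w in A) (X w)%:E)%E].

(* A version of E[X | H]; any two versions are almost surely equal. *)
Definition cond_exp (H : set (set Omega)) (X : Omega -> R) : Omega -> R :=
  xget (cst 0) [set Z | is_cond_exp H X Z].

End Conditioning.

(** * Random games *)

Record random_game (d : measure_display) (Omega : measurableType d) :=
  RandomGame {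
    gtree : Omega -> {fset word} ;
    outcome : Omega -> {fmap word -> bool} ;
    gtree_subtree : forall w, subtree (gtree w) ;
    outcome_domf : forall w, domf (outcome w) = leaves (gtree w) ;
    measurable_gtree : forall T, measurable [set w | gtree w = T] ;
    measurable_outcome : forall o, measurable [set w | outcome w = o]
  }.

(* R(x) *)
Definition value (d : measure_display) (Omega : measurableType d)
    (G : random_game Omega) (x : word) (w : Omega) : bool :=
  minimax (gtree G w) (outcome G w) x.

(* A_T *)
Definition event_A (d : measure_display) (Omega : measurableType d)
    (G : random_game Omega) (T : {fset word}) : set Omega :=
  [set w | T `<=` gtree G w /\ Dset (gtree G w) (leaves T) = fset0].

Definition branching_assumption (R : realType) (d : measure_display)
    (Omega : measurableType d) (P : probability Omega R)
    (G : random_game Omega) : Prop :=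
  forall T : {fset word}, subtree T -> (0 < P (event_A G T))%E ->
    cond_indep P (event_A G T) (leaves T)
      (fun x w => (subtree_at (gtree G w) x,
                   (outcome G w).[& subtree_at (gtree G w) x])).

Definition binary_bernoulli_game (R : realType) (d : measure_display)
    (Omega : measurableType d) (P : probability Omega R)
    (G : random_game Omega) (n : nat) : Prop :=
  [/\ forall w, gtree G w = binary_tree n,
      cond_indep P setT (leaves (binary_tree n)) (value G) &
      forall x, x \in leaves (binary_tree n) ->
        forall B : set bool,
          P (value G x @^-1` B) = bernoulli_prob (2^-1 : R) B].

(** * Simulation and algorithms *)

(* The random source of the algorithms: [rmatch n z] is the resulting leaf of
   a random match from z, should z be chosen for the (n+1)-st simulation, and
   [unif n] is X_n.  By [simulator_law], for any choice of one starting node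
   per simulation, these matches and the X_n are mutually independent and
   independent of the outcomes conditionally on the tree, with the right
   laws.  The joint law of [rmatch n z] and [rmatch n z'] is irrelevant, since
   a single match is simulated at each step. *)
Record simulator (R : realType) (d : measure_display)
    (Omega : measurableType d) (P : probability Omega R)
    (G : random_game Omega) := Simulator {
  rmatch : nat -> word -> Omega -> word ;
  unif : nat -> Omega -> R ;
  measurable_rmatch : forall n z y, measurable [set w | rmatch n z w = y] ;
  measurable_unif : forall n, measurable_fun setT (unif n) ;
  unif01 : forall n w, 0 <= unif n w <= 1 ;
  simulator_law :
    forall (n : nat) (T : {fset word}) (o : {fmap word -> bool})
      (z y : nat -> word) (A : nat -> set R),
      (forall i, z i \in T) -> (forall i, measurable (A i)) ->
      P [set w | [/\ gtree G w = T, outcome G w = o &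
                     forall i, (i < n)%N ->
                       rmatch i (z i) w = y i /\ A i (unif i w)]]
      = (P [set w | gtree G w = T /\ outcome G w = o] *
         \prod_(i < n) ((match_prob R T (z i) (y i))%:E *
                        uniform_prob (@ltr01 R) (A i)))%E
}.

Section Algorithms.
Context (R : realType) (d : measure_display) (Omega : measurableType d).
Variables (P : probability Omega R) (G : random_game Omega).
Variable S : simulator P G.

(* The functions m and s *)
Definition m_fun (T : {fset word}) (z : word) : R :=
  cprob P [set w | value G z w] (event_A G T).

(* K_{zy} for the leaf y reached by a match from z *)
Definition Kmatch (z : word) (w : Omega) : {fset word} :=
  [fset v in Kset (gtree G w) (rmatch S 0 z w) | desc z v].

(* All the matches [rmatch S n z] have the same joint law with the game; the
   one with n = 0 is used here. *)
Definition s_fun (T : {fset word}) (z : word) : R :=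
  let H := sigma_of (fun w =>
    (rmatch S 0 z w, Kmatch z w, value G (rmatch S 0 z w) w,
     `[< event_A G T w >])) in
  cexpect P
    (fun w => (cond_exp P H (fun v => (value G z v)%:R) w - m_fun T z) ^+ 2)
    (event_A G T).

(* The function F, of (B_X, D_X, (R(x))_{x in X}, u) *)
Definition strategy : Type :=
  {fset word} -> {fset word} -> {fmap word -> bool} -> R -> word.

(* The first three arguments range over countable sets. *)
Definition measurable_strategy (F : strategy) : Prop :=
  forall B D o z, measurable [set u | F B D o u = z].

Definition choice_of (F : strategy) (n : nat) (X : {fset word}) (w : Omega)
    : word :=
  F (Bset X) (Dset (gtree G w) X) (outcome G w).[& X] (unif S n w).

(* The sequence x_1, ..., x_n.  The first match starts from the root. *)
Fixpoint play (F : strategy) (n : nat) (w : Omega) : seq word :=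
  if n is k.+1 then
    let xs := play F k w in
    let z := if k == 0%N then [::] else choice_of F k [fset x in xs] w in
    rcons xs (if z \in xs then z else rmatch S k z w)
  else [::].

Definition explored (F : strategy) (n : nat) (w : Omega) : {fset word} :=
  [fset x in play F n w].

(* z_n, for n >= 1 *)
Definition chosen (F : strategy) (n : nat) (w : Omega) : word :=
  choice_of F n (explored F n w) w.

Definition admissible (F : strategy) : Prop :=
  measurable_strategy F /\
  forall n w, (0 < n)%N ->
    chosen F n w \in Dset (gtree G w) (explored F n w) `|` explored F n w.

(** ** The step-by-step algorithm *)

Section StepByStep.
Variables (X : {fset word}) (w : Omega).
Let T := gtree G w.

(* As for [minimax], #|` T | is enough fuel for the backward inductions. *)
Fixpoint Rn_rec (k : nat) (x : word) : R :=
  if x \in X then (value G x w)%:R else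
  if x \in Dset T X then m_fun (Kset T x) x else
  if k is j.+1 then
    if max_node x then 1 - \prod_(y <- children T x) (1 - Rn_rec j y)
    else \prod_(y <- children T x) Rn_rec j y
  else 0.

Definition Rn : word -> R := Rn_rec #|` T |.

Definition Un (x : word) : R :=
  if max_node (father x) then \prod_(y <- brothers T x) (1 - Rn y)
  else \prod_(y <- brothers T x) Rn y.

Fixpoint Zn_rec (k : nat) (x : word) : R :=
  if x \in X then 0 else
  if x \in Dset T X then s_fun (Kset T x) x else
  if k is j.+1 then
    \big[Num.max/0]_(y <- children T x) (Un y ^+ 2 * Zn_rec j y)
  else 0.

Definition Zn : word -> R := Zn_rec #|` T |.

Definition argmax_child (z y : word) : Prop :=
  y \in children T z /\
  forall y', y' \in children T z -> Un y' ^+ 2 * Zn y' <= Un y ^+ 2 * Zn y.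

(* [descent z z']: the descent along maximizing children, started at z, may
   end at z'. *)
Inductive descent : word -> word -> Prop :=
| descent_stop z : z \in X `|` Dset T X -> descent z z
| descent_step z y z' : z \notin X `|` Dset T X ->
    argmax_child z y -> descent y z' -> descent z z'.

(* The possible values of z_n, for an arbitrary way of breaking ties.  Stopping
   is the choice of an explored leaf, which leaves the explored set
   unchanged. *)
Definition step_rule (z : word) : Prop :=
  descent [::] z \/ ((Rn [::] = 0 \/ Rn [::] = 1) /\ z \in X).

End StepByStep.

Definition step_by_step (F : strategy) : Prop :=
  admissible F /\
  forall n w, (0 < n)%N -> step_rule (explored F n w) w (chosen F n w).

(** ** Mean square error *)

(* F_n *)
Definition filtration (F : strategy) (n : nat) : set (set Omega) :=
  sigma_of (fun w => (Bset (explored F n w),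
                      Dset (gtree G w) (explored F n w),
                      (outcome G w).[& explored F n w])).

(* E[(R_n(r) - R(r))^2] with R_n(r) = E[R(r) | F_n] *)
Definition mean_sq_error (F : strategy) (n : nat) : \bar R :=
  let root_value w : R := (value G [::] w)%:R in
  'E_P[fun w => (cond_exp P (filtration F n) root_value w - root_value w) ^+ 2].

End Algorithms.

(* Main.v *)
Require Import Defs.
From Stdlib Require Import NArith Lia.
From mathcomp Require Import all_boot all_order all_algebra.
From mathcomp Require Import finmap.
From mathcomp Require Import all_classical all_reals all_analysis measurable_realfun.
From mathcomp Require Import ring.

(** At depth 3 everything can be computed.  The vector of the eight outcomes is
    uniform, and whatever has been explored, the unexplored leaves remain
    independent fair bits; hence R_n(r) is the multilinear extension of the
    minimax function, with value 1/2 at the unexplored leaves.  This turns every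
    quantity (m, s, R_n, Z_n and the mean square errors) into a finite sum.

    The step-by-step algorithm has no real choice.  If R(x_1) = 1 it goes to the
    brother of the father of x_1, otherwise to the brother of x_1; its errors
    after two and three steps are 2107/16384 and 859/8192.  If instead, after
    R(x_1) = 0, the second match starts from the depth-1 node not above x_1 and
    the third one from the best node (the brother of x_1 or x_2 when
    R(x_2) = 0, the brother of the father of x_2 when R(x_2) = 1), the errors are
    2215/16384 and 847/8192: worse after two steps, better after three. *)

Set Implicit Arguments.
Unset Strict Implicit.
Unset Printing Implicit Defensive.

Import Order.TTheory GRing.Theory Num.Theory.
Import numFieldNormedType.Exports.

Local Open Scope classical_set_scope.
Local Open Scope fmap_scope.
Local Open Scope fset_scope.
Local Open Scope ring_scope.

(** Unexplored leaves stay fair by a likelihood argument: jointly with an outcome vector [t], a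
    given history of starting nodes and matches has a probability that depends on [t] only through
    the explored leaves, so the posterior is uniform on the compatible vectors. Brothers have
    disjoint sets of leaves below them, whence products in the minimax recursion. Three obstacles
    shape the proof. The law of the simulator is given for fixed starting nodes whereas a strategy
    picks random ones, so histories are split into countably many deterministic ones. [cond_exp] is
    an arbitrary version, and a match ends below its start only almost surely, so identities hold
    off null sets. The step-by-step strategy is any one that obeys the rule, with free ties and
    optional stopping; its node is forced because the maxima met are strict, except when the root is
    already known to be 1, and then the error is zero whatever comes next. Real numbers do not
    reduce, so quantities are carried as integers over explicit denominators. *)

Notation T3 := (binary_tree 3).

(** * The binary tree of depth 3 as explicit lists *)

Definition leafs : seq word := words [:: 1; 2]%N 3.
Definition nodes : seq word := flatten [seq words [:: 1; 2]%N k | k <- iota 0 4].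
Definition kids (x : word) : seq word := [:: rcons x 1%N; rcons x 2%N].

Lemma mem_T3 x : (x \in T3) = (x \in nodes).
Proof. by rewrite /binary_tree in_fset. Qed.

Lemma in_fset_filter (T : {fset word}) (p : pred word) x :
  (x \in [fset y in T | p y]) = (x \in T) && p x.
Proof. by rewrite in_fset inE. Qed.

Lemma T3_perm : perm_eq (enum_fset T3) nodes.
Proof.
apply: uniq_perm; [exact: fset_uniq|by vm_compute|].
by move=> x; rewrite mem_T3.
Qed.

Lemma card_T3 : #|` T3| = 15%N.
Proof. by rewrite (perm_size T3_perm). Qed.

(** Leaves a closed boolean for [vm_compute]: facts about the fifteen nodes are checked one by one
    instead of being derived from properties of prefixes. *)
Lemma all_nodes (p : pred word) : all p nodes -> forall x, x \in nodes -> p x.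
Proof. by move/allP. Qed.

Lemma all_nodes2 (p : rel word) : all (fun x => all (p x) nodes) nodes ->
  forall x y, x \in nodes -> y \in nodes -> p x y.
Proof. by move=> /allP h x y /h/allP; apply. Qed.

Lemma leafs_nodes x : x \in leafs -> x \in nodes.
Proof. by apply/allP; vm_compute. Qed.

Lemma size_leafs x : x \in leafs -> size x = 3%N.
Proof. by move=> xl; apply/eqP; move: x xl; apply/allP; vm_compute. Qed.

Lemma nodes_leafs x : x \in nodes -> (x \in leafs) = (size x == 3).
Proof. by move=> xn; apply/eqP; move: x xn; apply/allP; vm_compute. Qed.

Lemma nodes_size x : x \in nodes -> (size x <= 3)%N.
Proof. by move: x; apply/allP; vm_compute. Qed.

Lemma kids_nodes x : x \in nodes -> (size x < 3)%N -> {subset kids x <= nodes}.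
Proof.
move=> xn; have := all_nodes
  (p := fun x => (size x < 3)%N ==> all (mem nodes) (kids x)).
by move=> /(_ ltac:(by vm_compute) _ xn)/implyP h /h/allP.
Qed.

Lemma child_kids x y : x \in nodes -> y \in nodes ->
  child x y = (y \in kids x) && (size x < 3)%N.
Proof.
move=> xn yn; apply/eqP; move: x y xn yn; apply: all_nodes2; by vm_compute.
Qed.

Lemma children_T3 x : x \in nodes -> (size x < 3)%N ->
  perm_eq (enum_fset (children T3 x)) (kids x).
Proof.
move=> xn x3; apply: uniq_perm; first exact: fset_uniq.
  by rewrite /= inE; apply/andP; split=> //; apply/eqP => /rcons_inj[].
move=> y; rewrite in_fset_filter mem_T3.
apply/andP/idP => [[yn]|yk]; first by rewrite child_kids// => /andP[].
have yn := kids_nodes xn x3 yk; split=> //.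
by rewrite child_kids// yk.
Qed.

Lemma leaves_T3 x : (x \in leaves T3) = (x \in leafs).
Proof.
rewrite in_fset_filter mem_T3; apply/andP/idP => [[xn /eqP xE]|xl].
  rewrite nodes_leafs// eqn_leq nodes_size//= leqNgt; apply/negP => x3.
  have kn := kids_nodes xn x3 (mem_head _ _).
  have : rcons x 1%N \in subtree_at T3 x.
    by rewrite in_fset_filter mem_T3 kn /desc -cats1 prefix_prefix.
  by rewrite xE in_fset1 => /eqP/(congr1 size)/eqP; rewrite size_rcons gtn_eqF.
have xn := leafs_nodes xl; split=> //; apply/eqP/fsetP => y.
rewrite in_fset_filter mem_T3 in_fset1; apply/andP/eqP => [[yn]|->].
  have /implyP := all_nodes2 (p := fun x y => (size x == 3) ==> desc x y ==> (y == x))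
    ltac:(by vm_compute) xn yn.
  by rewrite -nodes_leafs// => /(_ xl)/implyP h /h/eqP.
by split=> //; rewrite /desc prefix_refl.
Qed.

(** * Outcomes of the leaves *)

Notation outs := (8.-tuple bool).

(** Takes a plain list, so that it also reads the lists enumerated in the final computation. *)
Definition ev (t : seq bool) (x : word) : bool := nth false t (index x leafs).

Definition tup (f : word -> bool) : outs := [tuple f (nth [::] leafs i) | i < 8].

Lemma ev_tup f x : x \in leafs -> ev (tup f) x = f x.
Proof.
move=> xl; have xi : (index x leafs < 8)%N by rewrite -index_mem in xl.
rewrite /ev -[index x leafs]/(nat_of_ord (Ordinal xi)) -tnth_nth tnth_mktuple.
by rewrite nth_index.
Qed.

Lemma ev_inj (t t' : outs) : {in leafs, ev t =1 ev t'} -> t = t'.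
Proof.
move=> h; apply: eq_from_tnth => i; rewrite !(tnth_nth false).
have il : nth [::] leafs i \in leafs by apply: mem_nth; case: i.
have := h _ il; rewrite /ev index_uniq//; by case: i {il}.
Qed.

Lemma tupE (t : outs) (f : word -> bool) : {in leafs, ev t =1 f} -> t = tup f.
Proof. by move=> h; apply: ev_inj => x xl; rewrite h// ev_tup. Qed.

Definition mix (S : pred word) (t t' : seq bool) : outs :=
  tup (fun x => if S x then ev t x else ev t' x).

Lemma ev_mix S t t' x : x \in leafs ->
  ev (mix S t t') x = if S x then ev t x else ev t' x.
Proof. by move=> xl; rewrite ev_tup. Qed.

(** Stands for measurability with respect to the outcomes at the leaves in [S]; under the uniform
    law, dependence on disjoint sets of leaves means independence. *)
Definition depends_on (S : pred word) A (f : outs -> A) :=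
  forall t t' : outs, {in leafs, forall x, S x -> ev t x = ev t' x} -> f t = f t'.

Lemma depends_onW (S S' : pred word) A (f : outs -> A) :
  {in leafs, subpred S S'} -> depends_on S f -> depends_on S' f.
Proof. by move=> SS' fS t t' h; apply: fS => x xl /(SS' _ xl); apply: h. Qed.

Section Averages.
Variable R : realType.
Implicit Types (f g : outs -> R) (S : pred word).

Definition avg f : R := (\sum_t f t) / 256%:R.

Lemma card_outs : #|{: outs}| = 256%N.
Proof. by rewrite card_tuple card_bool. Qed.

Lemma avg_const c : avg (fun=> c) = c.
Proof.
by rewrite /avg sumr_const card_outs -[c *+ _]mulr_natr mulfK ?pnatr_eq0.
Qed.

Lemma eq_avg f g : f =1 g -> avg f = avg g.
Proof. by move=> fg; rewrite /avg (eq_bigr _ (fun i _ => fg i)). Qed.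

Lemma avgB f g : avg (fun t => f t - g t) = avg f - avg g.
Proof. by rewrite /avg -mulrBl sumrB. Qed.

(* The map exchanging the S-parts of two outcome vectors is an involution of
   the square of the outcome space which turns f(t) g(t) into f(t) g(t'). *)
Lemma avgM_indep S f g : depends_on S f -> depends_on (predC S) g ->
  avg (fun t => f t * g t) = avg f * avg g.
Proof.
move=> fS gS; pose h (p : outs * outs) := (mix S p.1 p.2, mix S p.2 p.1).
have hK : involutive h.
  move=> [t t']; rewrite /h /=; congr (_, _); apply/esym/tupE => x xl;
    by rewrite /= !ev_mix//; case: (S x).
have E : \sum_(p : outs * outs) f p.1 * g p.1 =
         \sum_(p : outs * outs) f p.1 * g p.2.
  rewrite (reindex_inj (inv_inj hK)) /=; apply: eq_bigr => -[t t'] _ /=.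
  congr (_ * _); [apply: fS|apply: gS] => x xl /= Sx; rewrite ev_mix//.
    by rewrite Sx.
  by rewrite (negbTE Sx).
(* The factor 1, written as the average of a constant, makes both sides double sums over pairs of
   vectors, as in [E]. *)
rewrite -[LHS]mulr1 -[X in _ * X](avg_const 1) /avg [RHS]mulrACA [LHS]mulrACA.
congr (_ * _); rewrite !big_distrlr /= !pair_big /=.
under eq_bigr do rewrite mulr1.
exact: E.
Qed.

(** Flipping the bit at [x] is an involution of the vectors, so both values of this bit contribute
    equally. *)
Lemma avg_bit x (h : bool -> R) : x \in leafs ->
  avg (fun t => h (ev t x)) = (h true + h false) / 2.
Proof.
move=> xl; pose flip (t : outs) := tup (fun y => (y == x) (+) ev t y).
have flipK : involutive flip.
  move=> t; apply/esym/tupE => y yl; rewrite ev_tup// addbA addbb.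
  by rewrite addFb.
have E : \sum_(t : outs) h (ev t x) = \sum_(t : outs) h (~~ ev t x).
  rewrite (reindex_inj (inv_inj flipK)); apply: eq_bigr => t _.
  by rewrite ev_tup// eqxx.
apply: (@mulIf _ 2%:R); first by rewrite pnatr_eq0.
rewrite divfK ?pnatr_eq0// mulr_natr mulr2n {2}/avg E -/(avg _).
rewrite /avg -mulrDl -big_split /=.
rewrite -(avg_const (h true + h false)) /avg; congr (_ / _).
by apply: eq_bigr => t _; case: ev => //; rewrite addrC.
Qed.

End Averages.

(** * Minimax values on the binary tree *)

Fixpoint mm (h : nat) (o : word -> bool) (x : word) : bool :=
  if h is j.+1 then
    if max_node x then mm j o (rcons x 1%N) || mm j o (rcons x 2%N)
    else mm j o (rcons x 1%N) && mm j o (rcons x 2%N)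
  else o x.

Definition mval (o : word -> bool) (x : word) : bool := mm (3 - size x) o x.

Lemma kid1_nodes h x : x \in nodes -> (size x + h.+1 = 3)%N ->
  rcons x 1%N \in nodes /\ (size (rcons x 1%N) + h = 3)%N.
Proof.
move=> xn xh; split; last by rewrite size_rcons addSnnS.
by apply: (kids_nodes xn); rewrite ?mem_head// -xh addnS ltnS leq_addr.
Qed.

Lemma kid2_nodes h x : x \in nodes -> (size x + h.+1 = 3)%N ->
  rcons x 2%N \in nodes /\ (size (rcons x 2%N) + h = 3)%N.
Proof.
move=> xn xh; split; last by rewrite size_rcons addSnnS.
by apply: (kids_nodes xn); rewrite ?inE ?eqxx ?orbT// -xh addnS ltnS leq_addr.
Qed.

Lemma inner_lt h (x : word) : (size x + h.+1 = 3)%N -> (size x < 3)%N.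
Proof. by move=> <-; rewrite addnS ltnS leq_addr. Qed.

Lemma leaf_height x : x \in nodes -> (size x + 0 = 3)%N -> x \in leafs.
Proof. by move=> xn; rewrite addn0 => xh; rewrite nodes_leafs// xh. Qed.

Lemma desc_rcons x (i : nat) y : desc (rcons x i) y -> desc x y.
Proof. by rewrite /desc -cats1; apply: catl_prefix. Qed.

Lemma minimax_recE (o : {fmap word -> bool}) h k x : domf o = leaves T3 ->
  x \in nodes -> (size x + h = 3)%N -> (h <= k)%N ->
  minimax_rec T3 o k x = mm h (fun y => odflt false o.[? y]) x.
Proof.
move=> oT; elim: h k x => [|h IH] [|k] x xn xh //.
  move=> _ /=; have xl := leaf_height xn xh.
  have : x \in domf o by rewrite oT leaves_T3.
  by rewrite -fndSome; case: fnd.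
rewrite ltnS => hk; have x3 := inner_lt xh.
have [n1 h1] := kid1_nodes xn xh; have [n2 h2] := kid2_nodes xn xh.
have xo : x \notin domf o.
  by rewrite oT leaves_T3 nodes_leafs// neq_ltn x3.
rewrite /= (not_fnd xo) (perm_all _ (children_T3 xn x3)).
rewrite (perm_has _ (children_T3 xn x3)) /= !IH// orbF andbT.
by [].
Qed.

Lemma minimaxE (o : {fmap word -> bool}) x : domf o = leaves T3 ->
  x \in nodes -> minimax T3 o x = mval (fun y => odflt false o.[? y]) x.
Proof.
move=> oT xn; apply: minimax_recE => //; first by rewrite subnKC// nodes_size.
by rewrite card_T3 (leq_trans (leq_subr _ _)).
Qed.

Lemma mm_ext h o o' x : x \in nodes -> (size x + h = 3)%N ->
  {in leafs, forall y, desc x y -> o y = o' y} -> mm h o x = mm h o' x.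
Proof.
elim: h x => [|h IH] x xn xh oo' /=.
  by apply: oo'; [exact: leaf_height|exact: prefix_refl].
have [n1 h1] := kid1_nodes xn xh; have [n2 h2] := kid2_nodes xn xh.
by rewrite (IH (rcons x 1%N))//; [rewrite (IH (rcons x 2%N))//|]
  => y yl /desc_rcons; exact: oo'.
Qed.

Lemma mval_ext o o' x : x \in nodes ->
  {in leafs, forall y, desc x y -> o y = o' y} -> mval o x = mval o' x.
Proof. by move=> xn; apply: mm_ext; rewrite // subnKC// nodes_size. Qed.

(** Known outcomes on [X], fresh ones elsewhere: averaging over the fresh vector computes the
    conditional law given the outcomes on [X]. *)
Definition splice (X : pred word) (o o' : word -> bool) (x : word) : bool :=
  if X x then o x else o' x.

Lemma kids_disjoint x y : x \in nodes -> y \in nodes ->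
  desc (rcons x 1%N) y -> ~~ desc (rcons x 2%N) y.
Proof.
move=> xn yn; apply/implyP; move: x y xn yn; apply: all_nodes2; by vm_compute.
Qed.

Section Posterior.
Variable R : realType.

Fixpoint post (h : nat) (X : pred word) (o : word -> bool) (x : word) : R :=
  if h is j.+1 then
    if max_node x then
      1 - (1 - post j X o (rcons x 1%N)) * (1 - post j X o (rcons x 2%N))
    else post j X o (rcons x 1%N) * post j X o (rcons x 2%N)
  else if X x then (o x)%:R else 2^-1.

Lemma depends_splice X o h x : x \in nodes -> (size x + h = 3)%N ->
  depends_on (desc x) (fun t => (mm h (splice X o (ev t)) x)%:R : R).
Proof.
move=> xn xh t t' tt'; congr (_%:R); congr nat_of_bool; apply: mm_ext => //.
by move=> y yl xy; rewrite /splice; case: (X y) => //; apply: tt'.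
Qed.

(** Induction on the height: the values of the two children depend on disjoint sets of leaves, so
    the average of their product factorises. *)
Lemma avg_splice X o h x : x \in nodes -> (size x + h = 3)%N ->
  avg (fun t => (mm h (splice X o (ev t)) x)%:R) = post h X o x.
Proof.
elim: h x => [|h IH] x xn xh /=.
  rewrite /splice; case: (X x); first exact: avg_const.
  by rewrite (avg_bit (fun b : bool => b%:R))// ?leaf_height// addr0 div1r.
have [n1 h1] := kid1_nodes xn xh; have [n2 h2] := kid2_nodes xn xh.
have d1 := depends_splice X o n1 h1.
have d2 : depends_on (predC (desc (rcons x 1%N)))
    (fun t => (mm h (splice X o (ev t)) (rcons x 2%N))%:R : R).
  apply: depends_onW (depends_splice X o n2 h2) => y yl /=.
  by apply: contraTN; apply: kids_disjoint => //; exact: leafs_nodes.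
case: ifP => _; last first.
  rewrite -IH// -IH// -(avgM_indep d1 d2); apply: eq_avg => t.
  by rewrite -natrM mulnb.
(* At a max node it is the complements that multiply; each 1 is rewritten as the average of a
   constant so that [avgB] applies. *)
rewrite -IH// -IH// -[X in _ = X - _](@avg_const R) -[X in _ = _ - (X - _) * _](@avg_const R).
rewrite -[X in _ = _ - _ * (X - _)](@avg_const R) -!avgB.
rewrite -(@avgM_indep _ (desc (rcons x 1%N))).
- rewrite -avgB; apply: eq_avg => t.
  by do 2 case: mm => /=; rewrite !(subrr, mul0r, subr0, mulr0, mulr1).
- by move=> t t' tt'; rewrite (d1 t t' tt').
- by move=> t t' tt'; rewrite (d2 t t' tt').
Qed.

End Posterior.

(** This is 2 to the power 2^h: each of the 2^h leaves below a node of height [h] brings at most one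
    factor 1/2. *)
Fixpoint den (h : nat) : nat := if h is j.+1 then (den j * den j)%N else 2%N.

Fixpoint postN (h : nat) (X : pred word) (o : word -> bool) (x : word) : nat :=
  if h is j.+1 then
    if max_node x then
      (den h - (den j - postN j X o (rcons x 1)) * (den j - postN j X o (rcons x 2)))%N
    else (postN j X o (rcons x 1) * postN j X o (rcons x 2))%N
  else if X x then (o x).*2 else 1%N.

Lemma den_gt0 h : (0 < den h)%N.
Proof. by elim: h => //= h IH; rewrite muln_gt0 IH. Qed.

Lemma postN_le h X o x : (postN h X o x <= den h)%N.
Proof.
elim: h x => [|h IH] x /=; first by case: (X x); case: (o x).
by case: ifP => _; [exact: leq_subr|exact: leq_mul].
Qed.

Lemma postE (R : realType) h X o x :
  post R h X o x = (postN h X o x)%:R / (den h)%:R.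
Proof.
elim: h x => [|h IH] x /=.
  case: (X x); last by rewrite div1r.
  by case: (o x); rewrite ?mul0r // divff ?pnatr_eq0.
have d0 : (den h)%:R != 0 :> R by rewrite pnatr_eq0 -lt0n den_gt0.
rewrite !IH; case: ifP => _; last by rewrite !natrM invfM mulrACA.
rewrite natrB; last by apply: leq_mul; exact: leq_subr.
by rewrite !natrM !natrB ?postN_le//; field.
Qed.

(** * Random elements with countably many values *)

Section Discrete.
Local Open Scope classical_set_scope.
Context (R : realType) (d : measure_display) (Omega : measurableType d).
Variable P : probability Omega R.

(** Measurability into the discrete sigma-algebra; every set of values is allowed because [sigma_of]
    is built from all of them. *)
Definition discrete T (Y : Omega -> T) := forall C : set T, measurable (Y @^-1` C).

Lemma discrete_count (T : countType) (Y : Omega -> T) :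
  (forall y, measurable [set w | Y w = y]) -> discrete Y.
Proof.
move=> mY C; pose F y : set Omega := [set w | Y w = y /\ C y].
have -> : Y @^-1` C = (\bigcup_y F y)%classic.
  by apply/seteqP; split=> [w Cw|w [y _ [<-]]//]; exists (Y w).
apply: countable_bigcupT_measurable; first exact: countableP.
move=> y; have [Cy|nCy] := pselect (C y).
  by rewrite (_ : F y = [set w | Y w = y])//; apply/seteqP; split => w; [case|split].
by rewrite (_ : F y = set0)//; apply/seteqP; split => w // -[_ /nCy].
Qed.

Lemma discrete_fiber T (Y : Omega -> T) y :
  discrete Y -> measurable [set w | Y w = y].
Proof. by move/(_ [set y]). Qed.

Lemma discrete_cst T (x : T) : discrete (fun=> x).
Proof.
move=> C; have [Cx|nCx] := pselect (C x).
  by rewrite (_ : _ @^-1` C = setT)//; apply/seteqP; split.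
by rewrite (_ : _ @^-1` C = set0)//; apply/seteqP; split.
Qed.

Lemma discrete_comp T U (f : T -> U) (Y : Omega -> T) :
  discrete Y -> discrete (fun w => f (Y w)).
Proof. by move=> dY C; exact: (dY (f @^-1` C)). Qed.

(** Handles a random choice of random element, such as a match from a random node, by splitting
    along the countably many values of [Y]. *)
Lemma discrete_bind (T : countType) U (Y : Omega -> T) (Z : T -> Omega -> U) :
  discrete Y -> (forall y, discrete (Z y)) -> discrete (fun w => Z (Y w) w).
Proof.
move=> dY dZ C.
have -> : (fun w => Z (Y w) w) @^-1` C =
    (\bigcup_y ((Y @^-1` [set y]) `&` (Z y @^-1` C)))%classic.
  by apply/seteqP; split=> [w Cw|w [y _ [/= <-]]//]; exists (Y w).
apply: countable_bigcupT_measurable; first exact: countableP.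
by move=> y; apply: measurableI; [exact: dY|exact: dZ].
Qed.

Lemma discrete_pair (T U : countType) (Y : Omega -> T) (Z : Omega -> U) :
  discrete Y -> discrete Z -> discrete (fun w => (Y w, Z w)).
Proof.
move=> dY dZ; apply: (@discrete_bind _ _ Y (fun y w => (y, Z w))) => // y.
exact: (@discrete_comp _ _ (pair y)).
Qed.

Lemma integral_fibers (T : countType) (Y : Omega -> T) (C : set T)
    (f g : Omega -> \bar R) : discrete Y ->
  measurable_fun setT f -> measurable_fun setT g ->
  (forall w, 0 <= f w)%E -> (forall w, 0 <= g w)%E ->
  (forall y, C y ->
    \int[P]_(w in [set w | Y w = y]) f w = \int[P]_(w in [set w | Y w = y]) g w)%E ->
  (\int[P]_(w in Y @^-1` C) f w = \int[P]_(w in Y @^-1` C) g w)%E.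
Proof.
move=> dY mf mg f0 g0 fg.
(* The fibers are indexed by the codes of their values, to get a union over the integers; an integer
   that codes no value in [C] gives the empty set. *)
pose F k : set Omega := Y @^-1` [set y | C y /\ choice.pickle y = k].
have mF k : measurable (F k) by exact: dY.
have -> : Y @^-1` C = (\bigcup_k F k)%classic.
  by apply/seteqP; split=> [w Cw|w [k _ []]//]; exists (choice.pickle (Y w)).
have tF : trivIset setT F.
  by move=> i j _ _ [w [[_ <-] [_ <-]]].
rewrite !ge0_integral_bigcup//; [|exact: measurable_funTS|exact: measurable_funTS].
apply: eq_eseriesr => k _.
have [[y [Cy yk]]|nk] := pselect (exists y, C y /\ choice.pickle y = k).
  rewrite (_ : F k = [set w | Y w = y]) ?fg//; apply/seteqP; split => w /=.
    by case=> _; rewrite -yk => /(pcan_inj choice.pickleK).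
  by move=> Yw; split; rewrite Yw.
rewrite (_ : F k = set0) ?integral_set0//; apply/seteqP; split => w //= h.
by apply: nk; exists (Y w).
Qed.

Lemma measure_fibers (T : countType) (Y : Omega -> T) (C : set T) (A B : set Omega) :
  discrete Y -> measurable A -> measurable B ->
  (forall y, C y -> P (A `&` [set w | Y w = y])%classic = P (B `&` [set w | Y w = y])%classic) ->
  P (A `&` Y @^-1` C)%classic = P (B `&` Y @^-1` C)%classic.
Proof.
move=> dY mA mB h; have mC := dY C.
rewrite -integral_indic// -(integral_indic P (dY C))//.
apply: integral_fibers => //.
- exact/measurable_EFinP/measurable_indic.
- exact/measurable_EFinP/measurable_indic.
- move=> y Cy; have mY := discrete_fiber y dY.
  by rewrite !integral_indic//; exact: h.
Qed.

Lemma null_fibers (T : countType) (Y : Omega -> T) (C : set T) : discrete Y ->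
  (forall y, C y -> P [set w | Y w = y] = 0%E) -> P (Y @^-1` C) = 0%E.
Proof.
move=> dY h; rewrite -(setTI (Y @^-1` C)) (@measure_fibers _ _ _ _ set0)//.
  by rewrite set0I measure0.
by move=> y Cy; rewrite setTI set0I measure0 h.
Qed.

Lemma ae_fibers (T : countType) (Y : Omega -> T) (C : set T) : discrete Y ->
  (forall y, ~ C y -> P [set w | Y w = y] = 0%E) -> {ae P, forall w, C (Y w)}.
Proof.
move=> dY h; exists (Y @^-1` (~` C)); split; first exact: dY.
  by apply: null_fibers => // y; apply: h.
by move=> w /=.
Qed.

Lemma ae_atom (T : countType) (Y : Omega -> T) : discrete Y ->
  {ae P, forall w, P [set w' | Y w' = Y w] <> 0%E}.
Proof.
move=> dY; apply: (@ae_fibers _ Y [set y | P [set w' | Y w' = y] <> 0%E]) => //.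
by move=> y /= /contrapT.
Qed.

(** Equality with a function of [Y] is asked only almost everywhere, since the integrands contain an
    arbitrary version of a conditional expectation; the finite list [s] carries the whole law of
    [Y]. *)
Lemma ge0_integral_discrete (T : countType) (Y : Omega -> T) (s : seq T)
    (f : Omega -> R) (g : T -> R) : discrete Y -> uniq s ->
  (forall y, y \notin s -> P [set w | Y w = y] = 0%E) ->
  measurable_fun setT f -> (forall w, 0 <= f w) -> (forall y, 0 <= g y) ->
  {ae P, forall w, f w = g (Y w)} ->
  (\int[P]_w (f w)%:E = (\sum_(y <- s) fine (P [set w | Y w = y]) * g y)%:E)%E.
Proof.
move=> dY us Ps mf f0 g0 fg.
have mgY : measurable_fun setT (g \o Y).
  by move=> _ B mB; rewrite setTI; exact: (dY (g @^-1` B)).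
have mY y := discrete_fiber y dY.
rewrite (@ge0_ae_eq_integral _ _ _ _ _ _ (fun w => (g (Y w))%:E))//; first last.
- by apply: filterS fg => w /= -> _.
- by move=> w _; rewrite lee_fin.
- by move=> w _; rewrite lee_fin.
- exact/measurable_EFinP.
- exact/measurable_EFinP.
pose h y w : \bar R := (g y * \1_[set w | Y w = y] w)%:E.
have mh y : measurable_fun setT (h y).
  apply/measurable_EFinP; apply: measurable_funM; first exact: measurable_cst.
  have := @measurable_indic _ Omega R setT _ (mY y). exact.
have h0 y w : (0 <= h y w)%E by rewrite lee_fin mulr_ge0.
(* On a fiber listed in [s] a single term of the sum survives, and the fibers off [s] are null. *)
transitivity (\int[P]_w (\sum_(y <- s) h y w))%E; last first.
  rewrite ge0_integral_sum// -sumEFin; apply: eq_bigr => y _.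
  rewrite /h; under eq_integral do rewrite EFinM.
  rewrite ge0_integralZl//= ?lee_fin//; last first.
    exact/measurable_EFinP/(@measurable_indic _ Omega R setT _ (mY y)).
  rewrite integral_indic// setIT muleC EFinM; congr (_ * _)%E.
  by rewrite fineK// fin_num_measure.
rewrite -(preimage_setT Y); apply: integral_fibers => //.
- exact/measurable_EFinP.
- by apply: emeasurable_sum.
- by move=> w; rewrite lee_fin.
- by move=> w; apply: sume_ge0.
move=> y _; have [ys|ys] := boolP (y \in s); last first.
  have n0 (k : Omega -> \bar R) : measurable_fun setT k ->
      (\int[P]_(w in [set w | Y w = y]) k w = 0)%E.
    move=> mk; apply: null_set_integral => //; first exact: measurable_funTS.
    exact: Ps.
  by rewrite !n0//; [exact: emeasurable_sum|exact/measurable_EFinP].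
apply: eq_integral => w /set_mem /= wy.
rewrite (bigD1_seq y) //= big1 ?adde0; last first.
  move=> z /eqP zy; rewrite /h indicE memNset ?mulr0//= => wz.
  by apply: zy; rewrite -wy.
by rewrite /h indicE mem_set ?mulr1 ?wy.
Qed.

End Discrete.

Section ConditionalExpectation.
Local Open Scope classical_set_scope.
Context (R : realType) (d : measure_display) (Omega : measurableType d).
Variables (P : probability Omega R) (T : countType) (V : Omega -> T) (X : Omega -> R).
Hypotheses (dV : discrete V) (mX : measurable_fun setT X).
Hypothesis X01 : forall w, 0 <= X w <= 1.

Let atom v : set Omega := [set w | V w = v].

Let m_atom v : measurable (atom v). Proof. exact: discrete_fiber. Qed.

Let P_atom v : (fine (P (atom v)))%:E = P (atom v).
Proof. by rewrite fineK// fin_num_measure. Qed.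

Let iX0 v : (0 <= \int[P]_(w in atom v) (X w)%:E)%E.
Proof. by apply: integral_ge0 => w _; rewrite lee_fin; case/andP: (X01 w). Qed.

Let iX1 v : (\int[P]_(w in atom v) (X w)%:E <= P (atom v))%E.
Proof.
rewrite -[leRHS]mul1e -integral_cst//; apply: ge0_le_integral => //.
- by move=> w _; rewrite lee_fin; case/andP: (X01 w).
- by apply/measurable_EFinP; exact: measurable_funTS.
- by move=> w _; rewrite lee_fin; case/andP: (X01 w).
Qed.

Let iX_fin v : (\int[P]_(w in atom v) (X w)%:E)%E \is a fin_num.
Proof.
rewrite ge0_fin_numE//; apply: le_lt_trans (iX1 v) _.
by rewrite ltey_eq fin_num_measure.
Qed.

(** Witness that a version exists: the mean of [X] over an atom of [V]. On a null atom, division by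
    zero makes it 0. *)
Let ratio v : R := fine (\int[P]_(w in atom v) (X w)%:E)%E / fine (P (atom v)).

Let ratio01 v : 0 <= ratio v <= 1.
Proof.
have P0 : 0 <= fine (P (atom v)) by rewrite fine_ge0.
rewrite /ratio divr_ge0 ?fine_ge0//=.
have [->|Pn0] := eqVneq (fine (P (atom v))) 0; first by rewrite invr0 mulr0.
rewrite ler_pdivrMr ?mul1r; last by rewrite lt_neqAle eq_sym Pn0.
by rewrite fine_le// fin_num_measure.
Qed.

Let m_ratio : measurable_fun setT (ratio \o V).
Proof. by move=> _ B mB; rewrite setTI; exact: (dV (ratio @^-1` B)). Qed.

Lemma sigma_of_measurable A : sigma_of V A -> measurable A.
Proof. by case=> C _ <-; rewrite setTI; exact: dV. Qed.

Let ratio_cond_exp : is_cond_exp P (sigma_of V) X (ratio \o V).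
Proof.
split.
- by move=> B mB; exists (ratio @^-1` B); rewrite ?setTI.
- apply: measurable_bounded_integrable => //.
    by apply: le_lt_trans (probability_le1 _ _) (ltry _).
  exists 1; split; first exact: num_real.
  move=> M M1 w _ /=; have /andP[r0 r1] := ratio01 (V w).
  by rewrite ger0_norm// (le_trans r1)// ltW.
move=> _ [C _ <-]; rewrite setTI; apply: integral_fibers => //.
- exact/measurable_EFinP.
- exact/measurable_EFinP.
- by move=> w; rewrite lee_fin; case/andP: (ratio01 (V w)).
- by move=> w; rewrite lee_fin; case/andP: (X01 w).
move=> v _; rewrite -/(atom v) (eq_integral (cst (ratio v)%:E)); last first.
  by move=> w /set_mem /= ->.
rewrite -/(atom v) integral_cst// -[RHS]fineK ?iX_fin// -[X in (_ * X)%E = _]P_atom -EFinM; congr EFin.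
rewrite /ratio -/(atom v); have [P0|Pn0] := eqVneq (fine (P (atom v))) 0.
  rewrite P0 mulr0; apply/esym/eqP; rewrite eq_le; apply/andP; split.
    by rewrite -P0 fine_le// fin_num_measure.
  exact: fine_ge0.
by rewrite divfK.
Qed.

Lemma cond_expP : is_cond_exp P (sigma_of V) X (cond_exp P (sigma_of V) X).
Proof. by apply: xgetPex; exists (ratio \o V). Qed.

Lemma cond_exp_measurable : measurable_fun setT (cond_exp P (sigma_of V) X).
Proof.
by move=> _ B mB; rewrite setTI; have [/(_ B mB)/sigma_of_measurable] := cond_expP.
Qed.

(** Any version is measurable for sigma(V), hence constant on the atoms of [V]; on an atom of
    positive probability the integral identity fixes this constant. *)
Lemma cond_exp_atom w : P [set w' | V w' = V w] <> 0%E ->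
  cond_exp P (sigma_of V) X w =
  fine (\int[P]_(w' in [set w' | V w' = V w]) (X w')%:E)%E /
  fine (P [set w' | V w' = V w]).
Proof.
move=> Pn0; have [mZ _ intZ] := cond_expP.
set Z := cond_exp _ _ _ in mZ intZ *.
have Zc w' : V w' = V w -> Z w' = Z w.
  have [C _ /seteqP[h1 h2]] := mZ [set Z w] (measurable_set1 _).
  move=> VE; apply: h1; split=> //=; rewrite VE.
  by have [] := h2 w erefl.
have := intZ (atom (V w)); rewrite (eq_integral (cst (Z w)%:E)); last first.
  by move=> w' /set_mem /Zc ->.
have sA : sigma_of V (atom (V w)) by exists [set V w]; rewrite ?setTI.
move=> /(_ sA); rewrite integral_cst// -[X in (_ * X)%E = _]P_atom -EFinM => <- /=.
rewrite mulfK//; apply/eqP => P0; apply: Pn0.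
by rewrite -/(atom _) -P_atom P0.
Qed.

End ConditionalExpectation.

(** * The random outcomes *)

Definition fm (t : outs) : {fmap word -> bool} :=
  [fmap x : leaves T3 => ev t (val x)].

Lemma fnd_fm t x : (fm t).[? x] = if x \in leafs then Some (ev t x) else None.
Proof.
rewrite -leaves_T3; case: ifPn => xl; last by rewrite not_fnd.
by rewrite (in_fnd xl) ffunE.
Qed.

Lemma fm_restrict (X : {fset word}) (t t' : outs) :
  {in leafs, forall x, x \in X -> ev t x = ev t' x} <-> (fm t).[& X] = (fm t').[& X].
Proof.
split=> [h|h x xl xX].
  apply/fmapP => x; rewrite !fnd_restrict !fnd_fm.
  by case: ifP => // xX; case: ifP => // xl; rewrite h.
have := congr1 (fun f : {fmap word -> bool} => f.[? x]) h.
by rewrite !fnd_restrict !fnd_fm xX xl => -[].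
Qed.

Lemma bernoulli_half (R : realType) (b : bool) :
  bernoulli_prob (2^-1 : R) [set b]%classic = (2^-1)%:E.
Proof.
rewrite bernoulli_probE ?invr_ge0 ?invf_le1 ?ler1n ?ler0n// !diracE /unstable.onem.
have -> : 1 - 2^-1 = 2^-1 :> R by field.
by case: b; rewrite !classical_sets.in_set1 /= ?mule1 ?mule0 ?adde0 ?add0e.
Qed.

Section Outcomes.
Context (R : realType) (d : measure_display) (Omega : measurableType d).
Variables (P : probability Omega R) (G : random_game Omega).
Hypothesis hG : binary_bernoulli_game P G 3.

Definition out (w : Omega) : outs := tup (fun y => odflt false (outcome G w).[? y]).

Lemma gtreeE w : gtree G w = T3. Proof. by case: hG. Qed.

Lemma outcome_dom w : domf (outcome G w) = leaves T3.
Proof. by rewrite outcome_domf gtreeE. Qed.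

Lemma outcomeE w : outcome G w = fm (out w).
Proof.
apply/fmapP => x; rewrite fnd_fm -leaves_T3 -(outcome_dom w).
case: ifPn => xl; last by rewrite not_fnd.
rewrite ev_tup; last by rewrite -leaves_T3 -(outcome_dom w).
by rewrite in_fnd.
Qed.

Lemma fm_inj : injective fm.
Proof.
move=> t t' tt'; apply: ev_inj => x xl.
have := congr1 (fun f : {fmap word -> bool} => f.[? x]) tt'.
by rewrite !fnd_fm xl => -[].
Qed.

Lemma valueE x w : x \in nodes -> value G x w = mval (ev (out w)) x.
Proof.
move=> xn; rewrite /value gtreeE minimaxE ?outcome_dom//.
by apply: mval_ext => // y yl _; rewrite ev_tup.
Qed.

Lemma value_leaf x w : x \in leafs -> value G x w = ev (out w) x.
Proof. by move=> xl; rewrite valueE ?leafs_nodes// /mval size_leafs. Qed.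

Lemma discrete_outcome : discrete (outcome G).
Proof. by apply: discrete_count; exact: measurable_outcome. Qed.

Lemma discrete_out : discrete out.
Proof.
exact: (discrete_comp (fun o : {fmap word -> bool} => tup (fun y => odflt false o.[? y]))
  discrete_outcome).
Qed.

Lemma cprobT (E : set Omega) : cprob P E setT = fine (P E).
Proof. by rewrite /cprob setIT probability_setT divr1. Qed.

(** Independence is applied to all eight leaves at once, each prescribed bit having probability 1/2;
    256 is 2^8. *)
Lemma P_out t : P [set w | out w = t]%classic = (256%:R^-1)%:E.
Proof.
have [_ indep bern] := hG.
have := indep (leaves T3) (fun x => [set ev t x]%classic) (fun x => id).
have -> : [set w | forall x, x \in leaves T3 -> [set ev t x]%classic (value G x w)]%classic
    = [set w | out w = t]%classic.
  apply/seteqP; split=> w /= h.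
    by apply: ev_inj => x xl; rewrite -value_leaf// h// leaves_T3.
  by move=> x; rewrite leaves_T3 => xl; rewrite value_leaf// h.
rewrite cprobT => h; rewrite -[LHS]fineK; last first.
  by rewrite fin_num_measure//; exact: (discrete_fiber _ discrete_out).
rewrite h; congr EFin; rewrite (eq_big_seq (fun=> 2^-1)) => [|x xl]; last first.
  by rewrite cprobT (bern x xl [set ev t x]%classic) bernoulli_half.
rewrite big_const_seq count_predT iter_mulr mulr1.
rewrite (_ : size _ = 8%N) ?exprVn -?natrX//.
rewrite (@perm_size _ _ leafs)//; apply: uniq_perm => //.
  exact: fset_uniq.
exact: leaves_T3.
Qed.

Lemma integral_out (f : outs -> R) : (forall t, 0 <= f t) ->
  (\int[P]_w (f (out w))%:E = (avg f)%:E)%E.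
Proof.
move=> f0; rewrite (@ge0_integral_discrete _ _ _ P _ out (index_enum outs) _ f).
- rewrite /avg mulr_suml; congr EFin; apply: eq_bigr => t _.
  by rewrite P_out /= mulrC.
- exact: discrete_out.
- exact: index_enum_uniq.
- by move=> t; rewrite mem_index_enum.
- by move=> _ B mB; rewrite setTI; exact: (discrete_out (f @^-1` B)%classic).
- by [].
- by [].
- exact: aeW.
Qed.

Lemma P_out_set (C : pred outs) :
  P [set w | C (out w)]%classic = (avg (fun t => (C t)%:R))%:E.
Proof.
have mC : measurable [set w | C (out w)]%classic.
  exact: (discrete_out [set t | C t]%classic).
rewrite -integral_out//.
transitivity (\int[P]_w (\1_[set w | C (out w)]%classic w)%:E)%E.
  by rewrite integral_indic// setIT.
apply: eq_integral => w _; rewrite indicE; congr (_%:R)%:E; congr nat_of_bool.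
by apply/idP/idP => [/set_mem//|h]; apply/mem_set.
Qed.

End Outcomes.

(** * The branching assumption and the function m *)

Lemma desc_common x y z : desc x z -> desc y z -> (size x <= size y)%N -> desc x y.
Proof.
rewrite /desc !prefixE => /eqP xz /eqP yz xy; apply/eqP.
by rewrite -yz take_takel.
Qed.

Lemma in_leaves (K : {fset word}) x :
  (x \in leaves K) = (x \in K) && all (fun y => desc x y ==> (y == x)) (enum_fset K).
Proof.
rewrite in_fset_filter; case: (boolP (x \in K)) => //= xK.
apply/eqP/allP => [/fsetP h y yK|h].
  by apply/implyP => xy; have := h y; rewrite in_fset_filter yK xy in_fset1.
apply/fsetP => y; rewrite in_fset_filter in_fset1; apply/andP/eqP => [[yK xy]|->].
  by apply/eqP; have /implyP := h _ yK; apply.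
by split=> //; exact: prefix_refl.
Qed.

Lemma leaves_antichain (K : {fset word}) x y z : x \in leaves K -> y \in leaves K ->
  desc x z -> desc y z -> x = y.
Proof.
rewrite !in_leaves => /andP[xK /allP hx] /andP[yK /allP hy] xz yz.
have [xy|/ltnW yx] := leqP (size x) (size y).
  by have /implyP/(_ (desc_common xz yz xy))/eqP -> := hx _ yK.
by have /implyP/(_ (desc_common yz xz yx))/eqP -> := hy _ xK.
Qed.

(** Each condition involves only the leaves below its own node; as no word lies below two nodes of
    [s], the first condition is independent of the others. *)
Lemma avg_all_indep (R : realType) (s : seq word) (C : word -> outs -> bool) :
  uniq s -> (forall x y z, x \in s -> y \in s -> desc x z -> desc y z -> x = y) ->
  (forall x, x \in s -> depends_on (desc x) (C x)) ->
  avg (fun t => (all (fun x => C x t) s)%:R) =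
  \prod_(x <- s) avg (fun t => (C x t)%:R) :> R.
Proof.
elim: s => [|x s IH] /=; first by rewrite big_nil avg_const.
move=> /andP[xs us] dis dep; rewrite big_cons -IH//; first last.
- by move=> y ys; apply: dep; rewrite inE ys orbT.
- by move=> y y' z ys ys'; apply: dis; rewrite inE ?ys ?ys' orbT.
rewrite -(@avgM_indep _ (desc x)).
- by apply: eq_avg => t; rewrite -natrM mulnb.
- by move=> t t' tt'; rewrite (dep x (mem_head _ _) t t' tt').
move=> t t' tt'; congr (_%:R); congr nat_of_bool; apply: eq_in_all => y ys.
apply: dep; first by rewrite inE ys orbT.
move=> z zl yz; apply: tt' => //=; apply: contra xs => xz.
by rewrite (dis x y z)// inE ?eqxx// ys orbT.
Qed.

Section Branching.
Context (R : realType) (d : measure_display) (Omega : measurableType d).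
Variables (P : probability Omega R) (G : random_game Omega).
Hypothesis hG : binary_bernoulli_game P G 3.

(** The tree is deterministic, so conditioning on this event is either void or excluded by the
    positivity of its probability. *)
Lemma event_A_const K : event_A G K = setT \/ event_A G K = set0.
Proof.
have [h|h] := pselect (K `<=` T3 /\ Dset T3 (leaves K) = fset0); [left|right].
  by apply/seteqP; split=> // w _; rewrite /event_A /= (gtreeE hG).
by apply/seteqP; split=> // w; rewrite /event_A /= (gtreeE hG).
Qed.

Lemma event_A_T K : K `<=` T3 -> Dset T3 (leaves K) = fset0 -> event_A G K = setT.
Proof. by move=> KT D0; apply/seteqP; split=> // w _; rewrite /event_A /= (gtreeE hG). Qed.

Lemma branching_binary : branching_assumption P G.
Proof.
move=> K _; have [->|->] := event_A_const K; last by rewrite measure0 ltxx.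
move=> _ J E JK.
pose C x (t : outs) := `[< E x (subtree_at T3 x, (fm t).[& subtree_at T3 x]) >].
have CE x w : C x (out G w) <->
    E x (subtree_at (gtree G w) x, (outcome G w).[& subtree_at (gtree G w) x]).
  by rewrite (gtreeE hG) (outcomeE hG); split => /asboolP.
rewrite cprobT (_ : [set w | _]%classic = [set w | all (fun x => C x (out G w)) J]%classic).
  rewrite (P_out_set hG (fun t => all (fun x => C x t) J)) /= avg_all_indep.
  - apply: eq_big_seq => x xJ.
    rewrite cprobT (_ : [set w | _]%classic = [set w | C x (out G w)]%classic).
      by rewrite (P_out_set hG (C x)).
    by apply/seteqP; split=> w /= /CE.
  - exact: fset_uniq.
  - move=> x y z /JK xK /JK yK; exact: (@leaves_antichain K).
  move=> x xJ t t' tt'; rewrite /C; do 3 congr (_ _).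
  apply/fm_restrict => y yl; rewrite in_fset_filter => /andP[_].
  exact: tt'.
apply/seteqP; split=> w /= h; first by apply/allP => x /h/CE.
by move=> x xJ; apply/CE; move/allP: h; apply.
Qed.

End Branching.

(** * Computable list versions of B, D, K and of the leaves *)

Definition bset (xs : seq word) : seq word := flatten [seq branch x | x <- xs].

Definition dset (xs : seq word) : seq word :=
  [seq w <- nodes | has (fun y => brother y w) (bset xs) && (w \notin bset xs)].

Definition kset (x : word) : seq word :=
  [seq w <- nodes | has (fun y => (w == y) || brother y w) (branch x)].

Definition lset (ks : seq word) : seq word :=
  [seq x <- ks | all (fun y => desc x y ==> (y == x)) ks].

Lemma mem_flatten_map (f : word -> seq word) (s1 s2 : seq word) : s1 =i s2 ->
  flatten [seq f x | x <- s1] =i flatten [seq f x | x <- s2].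
Proof.
by move=> s12 w; apply/flatten_mapP/flatten_mapP => -[x xs wx]; exists x;
  rewrite // ?s12// -s12.
Qed.

Lemma Bset_mem (X : {fset word}) xs : X =i xs -> Bset X =i bset xs.
Proof. by move=> Xxs w; rewrite in_fset; apply: mem_flatten_map. Qed.

Lemma Dset_mem (X : {fset word}) xs : X =i xs -> Dset T3 X =i dset xs.
Proof.
move=> Xxs w; rewrite in_fset_filter mem_filter mem_T3 andbC; congr (_ && _).
by rewrite (Bset_mem Xxs); congr (_ && _); apply: eq_has_r; exact: Bset_mem.
Qed.

Lemma Kset_mem x : Kset T3 x =i kset x.
Proof. by move=> w; rewrite in_fset_filter mem_filter mem_T3 andbC. Qed.

Lemma leaves_mem (K : {fset word}) ks : K =i ks -> leaves K =i lset ks.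
Proof.
move=> Kks x; rewrite in_leaves mem_filter andbC Kks; congr (_ && _).
exact: eq_all_r.
Qed.

(** K_x contains the brothers of all its nodes, so its leaves leave no brother to discover and the
    event is sure. *)
Lemma event_A_Kset (R : realType) (d : measure_display) (Omega : measurableType d)
    (P : probability Omega R) (G : random_game Omega) x :
  binary_bernoulli_game P G 3 -> x \in nodes -> event_A G (Kset T3 x) = setT.
Proof.
move=> hG xn; apply: (event_A_T hG).
  by apply/fsubsetP => w; rewrite in_fset_filter => /andP[].
apply/fsetP => w; rewrite (Dset_mem (leaves_mem (Kset_mem x))) in_fset0.
have /eqP -> // := all_nodes (p := fun x => dset (lset (kset x)) == [::])
  ltac:(by vm_compute) xn.
Qed.

Lemma m_funE (R : realType) (d : measure_display) (Omega : measurableType d)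
    (P : probability Omega R) (G : random_game Omega) x :
  binary_bernoulli_game P G 3 -> x \in nodes ->
  m_fun P G (Kset T3 x) x = post R (3 - size x) pred0 xpredT x.
Proof.
move=> hG xn; rewrite /m_fun (event_A_Kset hG xn) cprobT.
rewrite (_ : [set w | _]%classic = [set w | mval (ev (out G w)) x]%classic); last first.
  by apply/seteqP; split=> w /=; rewrite (valueE hG).
rewrite (P_out_set hG (fun t => mval (ev t) x)) /=.
by rewrite -avg_splice ?subnKC ?nodes_size.
Qed.

(** * Random matches and the function s *)

Definition mprob (R : realType) (z y : word) : R :=
  ((y \in leafs) && desc z y)%:R / 2%:R ^+ (3 - size z).

Lemma desc_kids z y : z \in nodes -> y \in leafs -> (size z < 3)%N ->
  desc z y = desc (rcons z 1%N) y || desc (rcons z 2%N) y.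
Proof.
move=> zn yl z3; have yn := leafs_nodes yl.
have := all_nodes2 (p := fun z y => (size z < 3)%N && (size y == 3) ==>
  (desc z y == desc (rcons z 1%N) y || desc (rcons z 2%N) y))
  ltac:(by vm_compute) zn yn.
by rewrite z3 -nodes_leafs// yl => /eqP.
Qed.

Lemma desc_leafs z y : z \in leafs -> y \in leafs -> desc z y = (z == y).
Proof.
move=> zl yl; have := all_nodes2 (p := fun z y => (size z == 3) && (size y == 3) ==>
  (desc z y == (z == y))) ltac:(by vm_compute) (leafs_nodes zl) (leafs_nodes yl).
by rewrite -!nodes_leafs ?leafs_nodes// zl yl => /eqP.
Qed.

Lemma match_prob_recE (R : realType) h k z y :
  z \in nodes -> (size z + h = 3)%N -> (h <= k)%N ->
  match_prob_rec R T3 k z y = ((y \in leafs) && desc z y)%:R / 2%:R ^+ h.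
Proof.
elim: h k z => [|h IH] k z zn zh hk.
  have zl := leaf_height zn zh.
  have -> : match_prob_rec R T3 k z y = (z == y)%:R.
    by case: k {hk} => [|k] /=; rewrite leaves_T3 zl.
  rewrite divr1; congr (_%:R); congr nat_of_bool.
  have [yl|yl] := boolP (y \in leafs); first by rewrite desc_leafs.
  by apply/eqP => zy; rewrite -zy zl in yl.
case: k hk => // k; rewrite ltnS => hk; have z3 := inner_lt zh.
have [n1 h1] := kid1_nodes zn zh; have [n2 h2] := kid2_nodes zn zh.
rewrite /= leaves_T3 nodes_leafs// ltn_eqF//.
rewrite (perm_big _ (children_T3 zn z3)) (perm_size (children_T3 zn z3)) /=.
rewrite !big_cons big_nil addr0 !IH// -mulrDr -mulrDl -natrD exprS invfM mulrCA.
congr (_ * (_ / _)); rewrite -?mulrA; congr (_%:R).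
have [yl|//] := boolP (y \in leafs); rewrite (desc_kids zn yl z3) /=.
have := @kids_disjoint z y zn (leafs_nodes yl).
by case: (desc (rcons z 1%N) y) => [/(_ isT)/negbTE ->|_]; rewrite ?add0n ?addn0.
Qed.

Lemma match_probE (R : realType) z y : z \in nodes ->
  match_prob R T3 z y = mprob R z y.
Proof.
move=> zn; apply: match_prob_recE => //; first by rewrite subnKC ?nodes_size.
by rewrite card_T3 (leq_trans (leq_subr _ _)).
Qed.

Definition agree (X : pred word) (t t' : seq bool) : bool :=
  all (fun x => X x ==> (ev t x == ev t' x)) leafs.

Lemma agreeP (X : pred word) (t t' : seq bool) :
  reflect {in leafs, forall x, X x -> ev t x = ev t' x} (agree X t t').
Proof.
apply: (iffP allP) => [h x xl Xx|h x xl]; first by have := h _ xl; rewrite Xx => /eqP.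
by apply/implyP => /(h _ xl) ->.
Qed.

(** Elementary conditioning: on the vectors that agree with [t0] on [X], the value at [z] equals its
    spliced version, which depends on the outcomes off [X] only and is therefore independent of the
    agreement. *)
Lemma agree_sum (R : realType) (X : pred word) (t0 : outs) z : z \in nodes ->
  \sum_(t : outs) (agree X t t0)%:R * (mval (ev t) z)%:R =
  (\sum_(t : outs) (agree X t t0)%:R) * post R (3 - size z) X (ev t0) z.
Proof.
move=> zn; have zh : (size z + (3 - size z) = 3)%N by rewrite subnKC ?nodes_size.
rewrite -avg_splice//; pose g (t : outs) : R := (mm (3 - size z) (splice X (ev t0) (ev t)) z)%:R.
have E : (\sum_(t : outs) (agree X t t0)%:R * (mval (ev t) z)%:R) / 256%:R =
    avg (fun t : outs => (agree X t t0)%:R * g t) :> R.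
  rewrite /avg; congr (_ / _); apply: eq_bigr => t _.
  have [/agreeP h|_] := boolP (agree X t t0); last by rewrite !mul0r.
  congr (_ * _%:R); congr nat_of_bool; apply: mm_ext => // y yl _.
  by rewrite /splice; case: ifP => // Xy; exact: h.
rewrite (@avgM_indep _ X) in E.
- apply: (@mulIf _ (256%:R^-1)); first by rewrite invr_eq0 pnatr_eq0.
  by rewrite E mulrAC.
- move=> t t' tt'; congr (_%:R); congr nat_of_bool.
  by apply/agreeP/agreeP => h x xl Xx; rewrite -h// tt'.
- move=> t t' tt'; congr (_%:R); congr nat_of_bool; apply: mm_ext => // y yl _.
  by rewrite /splice; case: ifPn => // nXy; exact: tt'.
Qed.

Lemma post_ext (R : realType) h (X : pred word) (o o' : word -> bool) x : (forall y, X y -> o y = o' y) ->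
  post R h X o x = post R h X o' x.
Proof.
move=> oo'; elim: h x => [|h IH] x /=; last by rewrite !IH.
by case: ifP => // /oo' ->.
Qed.

Section Simulation.
Context (R : realType) (d : measure_display) (Omega : measurableType d).
Variables (P : probability Omega R) (G : random_game Omega).
Hypothesis hG : binary_bernoulli_game P G 3.
Local Notation out := (out G).

Lemma measurable_out (f : outs -> R) : measurable_fun setT (f \o out).
Proof. by move=> _ B mB; rewrite setTI; exact: (discrete_out G (f @^-1` B)%classic). Qed.

Lemma integral_out_on (A : set Omega) (p : outs -> R) (f : outs -> R) :
  measurable A -> (forall t, 0 <= f t) ->
  (forall t, P [set w | A w /\ out w = t]%classic = (p t)%:E) ->
  (\int[P]_(w in A) (f (out w))%:E = (\sum_t p t * f t)%:E)%E.
Proof.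
move=> mA f0 pE.
pose Y w := (`[< A w >], out w).
have dA : discrete (fun w => `[< A w >]).
  apply: discrete_count => -[].
    by rewrite (_ : [set w | _]%classic = A)//; apply/seteqP; split => w /asboolP.
  rewrite (_ : [set w | _]%classic = (~` A)%classic); first exact: measurableC.
  by apply/seteqP; split => w /=; [move/negbT/asboolPn|move/asboolPn/negbTE].
transitivity (\int[P]_w (`[< A w >]%:R * f (out w))%:E)%E.
  rewrite integral_mkcond; apply: eq_integral => w _; rewrite patchE.
  have [Aw|nAw] := pselect (A w); first by rewrite mem_set// asboolT// mul1r.
  by rewrite memNset// asboolF// mul0r.
rewrite [LHS](@ge0_integral_discrete _ _ _ P _ Y (index_enum (bool * outs)%type)
  (fun w => `[< A w >]%:R * f (out w))
  (fun y => y.1%:R * f y.2)).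
- rewrite (eq_bigr (fun y => fine (P [set w | Y w = (y.1, y.2)]%classic) * (y.1%:R * f y.2)));
    last by case.
  rewrite -(pair_bigA _ (fun b t => fine (P [set w | Y w = (b, t)]%classic) * (b%:R * f t))).
  rewrite big_bool /= [X in _ + X]big1 ?addr0; last first.
    by move=> t _; rewrite mul0r mulr0.
  congr EFin.
  apply: eq_bigr => t _; rewrite mul1r; congr (_ * _).
  rewrite (_ : [set w | _]%classic = [set w | A w /\ out w = t]%classic) ?pE//.
  apply/seteqP; split => w /=; rewrite /Y; first by case=> /asboolP.
  by case=> Aw ->; rewrite asboolT.
- apply: discrete_pair => //; exact: discrete_out.
- exact: index_enum_uniq.
- by move=> y; rewrite mem_index_enum.
- apply: measurable_funM; last exact: measurable_out.
  by move=> _ B mB; rewrite setTI; exact: (dA (fun b => B b%:R)).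
- by move=> w; rewrite mulr_ge0.
- by move=> y; rewrite mulr_ge0.
- exact: aeW.
Qed.

(** Bayes with a constant likelihood: the observed value of [V] has the same joint probability [k]
    with every vector compatible with the outcomes on [X], and 0 with the others, so the posterior
    is uniform on the compatible ones. It serves for a single match and for a whole history. *)
Lemma cond_exp_post (T : countType) (V : Omega -> T) (X : pred word) (k : R) w z :
  discrete V -> z \in nodes -> P [set w' | V w' = V w]%classic <> 0%E ->
  (forall t, P [set w' | V w' = V w /\ out w' = t]%classic =
     (if agree X t (out w) then k else 0)%:E) ->
  cond_exp P (sigma_of V) (fun v => (value G z v)%:R) w =
  post R (3 - size z) X (ev (out w)) z.
Proof.
move=> dV zn P0 Pt; have mV := discrete_fiber (V w) dV.
have vE : (fun v => (value G z v)%:R) = (fun t => (mval (ev t) z)%:R : R) \o out.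
  by apply/funext => v /=; rewrite (valueE hG).
rewrite cond_exp_atom//; first last.
- by move=> v; case: value; rewrite lexx ler01.
- rewrite vE; exact: (measurable_out (fun t => (mval (ev t) z)%:R)).
rewrite (eq_integral (fun v => ((mval (ev (out v)) z)%:R)%:E)); last first.
  by move=> v _; rewrite (valueE hG).
rewrite (@integral_out_on _ _ (fun t => (mval (ev t) z)%:R) mV _ Pt)//=.
have PE : fine (P [set w' | V w' = V w]%classic) =
    \sum_(t : outs) (if agree X t (out w) then k else 0).
  have := integral_out_on mV (fun=> ler01) Pt.
  rewrite (eq_integral (cst 1%E))// integral_cst// mul1e => ->.
  by apply: eq_bigr => t _; rewrite mulr1.
have kE (t : outs) : (if agree X t (out w) then k else 0) = k * (agree X t (out w))%:R.
  by case: ifP; rewrite ?mulr1 ?mulr0.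
have nz : k * \sum_(t : outs) (agree X t (out w))%:R != 0.
  apply/eqP => h; apply: P0; rewrite -[LHS]fineK ?fin_num_measure// PE.
  by under eq_bigr do rewrite kE; rewrite -mulr_sumr h.
rewrite PE; under eq_bigr do rewrite kE -mulrA.
under [X in _ / X = _]eq_bigr do rewrite kE.
by rewrite -!mulr_sumr agree_sum// mulrA [LHS]mulrAC divff// mul1r.
Qed.

End Simulation.

(** At heights 0, 1, 2 the prior probabilities of the value 1 are 1/2, 3/4 and 9/16. *)
Definition mN (h : nat) : nat := nth 0%N [:: 1; 3; 9]%N h.
(** Numerators over the square of [den]: seeing one leaf moves 1/2, 3/4, 9/16 by exactly 1/2, 1/4,
    3/16, up or down. *)
Definition sN (h : nat) : nat := nth 0%N [:: 1; 1; 9]%N h.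
(** One of the two truncated differences vanishes, so this is a squared distance. *)
Definition sqd (a b : nat) : nat := ((a - b + (b - a)) ^ 2)%N.

Lemma sqdE (R : realType) a b : (sqd a b)%:R = (a%:R - b%:R) ^+ 2 :> R.
Proof.
rewrite /sqd natrX natrD; have [ab|/ltnW ba] := leqP a b.
  by rewrite (eqP ab) natrB// add0r -sqrrN opprB.
by rewrite (eqP ba) natrB// addr0.
Qed.

Lemma postN_m x : x \in nodes -> (0 < size x)%N ->
  postN (3 - size x) pred0 xpredT x = mN (3 - size x).
Proof.
move=> xn x0; have := all_nodes (p := fun x => (0 < size x)%N ==>
  (postN (3 - size x) pred0 xpredT x == mN (3 - size x))) ltac:(by vm_compute) xn.
by rewrite x0 => /eqP.
Qed.

(** There are 2^h leaves below [z], each with two outcomes, and each of these cases contributes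
    [sN h]. *)
Lemma postN_s z : z \in nodes -> (0 < size z)%N ->
  let h := (3 - size z)%N in
  (\sum_(y <- leafs | desc z y)
    (sqd (postN h (pred1 y) xpredT z) (mN h) + sqd (postN h (pred1 y) xpred0 z) (mN h)) =
  sN h * 2 ^ h.+1)%N.
Proof.
move=> zn z0; rewrite unlock; have := all_nodes (p := fun z => (0 < size z)%N ==>
  (reducebig 0%N leafs (fun y => BigBody y addn (desc z y)
    (sqd (postN (3 - size z) (pred1 y) xpredT z) (mN (3 - size z)) +
     sqd (postN (3 - size z) (pred1 y) xpred0 z) (mN (3 - size z)))%N) ==
  sN (3 - size z) * 2 ^ (3 - size z).+1)%N) ltac:(by vm_compute) zn.
by rewrite z0 => /eqP.
Qed.

Section FunctionS.
Context (R : realType) (d : measure_display) (Omega : measurableType d).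
Variables (P : probability Omega R) (G : random_game Omega).
Hypothesis hG : binary_bernoulli_game P G 3.
Variable S : simulator P G.
Local Notation out := (out G).

Lemma discrete_rmatch n z : discrete (rmatch S n z).
Proof. by apply: discrete_count; exact: measurable_rmatch. Qed.

Lemma sim_law n (t : outs) (z y : nat -> word) (A : nat -> set R) :
  (forall i, (i < n)%N -> z i \in nodes) -> (forall i, measurable (A i)) ->
  P [set w | out w = t /\ forall i, (i < n)%N ->
      rmatch S i (z i) w = y i /\ A i (unif S i w)]%classic =
  ((256%:R^-1)%:E * \prod_(i < n) ((mprob R (z i) (y i))%:E *
     uniform_prob (@ltr01 R) (A i)))%E.
Proof.
(* The law of the simulator asks for nodes of the tree at every index; from [n] on, where nothing is
   constrained, the root is used. *)
move=> zn mA; pose z' i := if (i < n)%N then z i else [::].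
have z'n i : z' i \in T3 by rewrite mem_T3 /z'; case: ifP => // /zn.
have := simulator_law S n (fm t) y z'n mA.
rewrite (_ : [set w | [/\ _, _ & _]]%classic = [set w | out w = t /\ forall i, (i < n)%N ->
      rmatch S i (z i) w = y i /\ A i (unif S i w)]%classic); last first.
  apply/seteqP; split => w /=; rewrite (gtreeE hG) (outcomeE hG).
    case=> _ /fm_inj <- h; split=> // i ni; have := h i ni.
    by rewrite /z' ni.
  by case=> -> h; split=> // i ni; have := h i ni; rewrite /z' ni.
rewrite (_ : [set w | gtree G w = T3 /\ outcome G w = fm t]%classic =
    [set w | out w = t]%classic); last first.
  apply/seteqP; split => w /=; rewrite (gtreeE hG) (outcomeE hG).
    by case=> _ /fm_inj.
  by move=> ->.
move=> ->; rewrite (P_out hG); congr (_ * _)%E; apply: eq_bigr => i _.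
by rewrite match_probE /z' ltn_ord// zn.
Qed.

Lemma rmatch0_law (t : outs) z y : z \in nodes ->
  P [set w | (rmatch S 0 z w, out w) = (y, t)]%classic = (mprob R z y / 256%:R)%:E.
Proof.
move=> zn; have := @sim_law 1 t (fun=> z) (fun=> y) (fun=> setT).
rewrite big_ord1 probability_setT mule1 -EFinM mulrC => <- //.
congr (P _); apply/seteqP; split => w /=; first by case=> <- <-; split=> // -[].
by case=> -> /(_ 0%N isT)[->].
Qed.

(** The event A is sure and K_{zy} is a function of the leaf y, so the observation amounts to this
    leaf and its outcome, and the posterior is [post] with one explored leaf. *)
Lemma s_funE z : z \in nodes -> (0 < size z)%N ->
  s_fun S (Kset T3 z) z =
  (sN (3 - size z))%:R / (den (3 - size z))%:R ^+ 2.
Proof.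
move=> zn z0; rewrite /s_fun; set V := fun w : Omega => (_, _, _, _).
set h := (3 - size z)%N.
have dY : discrete (fun w => (rmatch S 0 z w, outcome G w)).
  by apply: discrete_pair; [exact: discrete_rmatch|exact: discrete_outcome].
pose phi (p : word * {fmap word -> bool}) : (word * {fset word} * bool * bool)%type :=
  (p.1, [fset v in Kset T3 p.1 | desc z v], minimax T3 p.2 p.1, true).
have VE : V = fun w => phi (rmatch S 0 z w, outcome G w).
  apply/funext => w; rewrite /V /phi /Kmatch /value !(gtreeE hG) /=.
  by rewrite (event_A_Kset hG zn) asboolT.
have dV : discrete V by rewrite VE; exact: (discrete_comp phi dY).
rewrite (event_A_Kset hG zn) /cexpect probability_setT divr1.
pose g (p : word * outs) : R :=
  (post R h (pred1 p.1) (ev p.2) z - post R h pred0 xpredT z) ^+ 2.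
have dYo : discrete (fun w => (rmatch S 0 z w, out w)).
  by apply: discrete_pair; [exact: discrete_rmatch|exact: discrete_out].
have Yae : {ae P, forall w, rmatch S 0 z w \in leafs /\ desc z (rmatch S 0 z w)}.
  apply: (@ae_fibers _ _ _ P _ (fun w => (rmatch S 0 z w, out w))
    [set p | p.1 \in leafs /\ desc z p.1]%classic) => // -[y t] /= nyz.
  rewrite rmatch0_law// /mprob; case: andP => [//|_].
  by rewrite mul0r mul0r.
have mV : measurable_fun setT (cond_exp P (sigma_of V) (fun v => (value G z v)%:R)).
  apply: cond_exp_measurable => //.
    rewrite (_ : (fun _ => _) = (fun t => (mval (ev t) z)%:R : R) \o out).
      exact: (measurable_out G (fun t => (mval (ev t) z)%:R)).
    by apply/funext => v /=; rewrite (valueE hG).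
  by move=> v; case: value; rewrite lexx ler01.
rewrite (@ge0_integral_discrete _ _ _ P _ (fun w => (rmatch S 0 z w, out w))
  [seq (y, t) | y <- leafs, t <- index_enum outs] _ g dYo).
- rewrite big_allpairs /=.
  transitivity (\sum_(y <- leafs) mprob R z y * ((post R h (pred1 y) xpredT z -
      post R h pred0 xpredT z) ^+ 2 + (post R h (pred1 y) xpred0 z -
      post R h pred0 xpredT z) ^+ 2) / 2).
    (* For a fixed leaf only its own bit is read, so the average over vectors is the mean over the
       two values of that bit. *)
    apply: eq_big_seq => y yl; rewrite -mulrA.
    rewrite -(avg_bit (fun b => (post R h (pred1 y) (fun=> b) z -
      post R h pred0 xpredT z) ^+ 2) yl) /avg mulrA mulrAC mulr_sumr.
    apply: eq_bigr => t _; rewrite rmatch0_law//= /g.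
    rewrite (@post_ext _ _ _ _ (fun=> ev t y))//.
    by move=> y' /eqP ->.
  rewrite /mprob; under eq_bigr do rewrite !postE postN_m//.
  rewrite -/h; set D := (den h)%:R.
  have D0 : D != 0 by rewrite pnatr_eq0 -lt0n den_gt0.
  have sq (a b : nat) : (a%:R / D - b%:R / D) ^+ 2 = (sqd a b)%:R / D ^+ 2.
    by rewrite sqdE -mulrBl expr_div_n.
  under eq_bigr do rewrite !sq.
  have E2 : 2%:R ^+ h != 0 :> R by rewrite expf_neq0// pnatr_eq0.
  transitivity ((\sum_(y <- leafs | desc z y)
    (sqd (postN h (pred1 y) xpredT z) (mN h) + sqd (postN h (pred1 y) xpred0 z) (mN h)))%N%:R
      / (2%:R * 2%:R ^+ h * D ^+ 2)).
    rewrite natr_sum mulr_suml [RHS]big_mkcond /=; apply: eq_big_seq => y yl.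
    rewrite yl /=; case: desc; last by rewrite !mul0r.
    rewrite natrD (_ : true%:R = 1 :> R)//; move: E2; set E := 2%:R ^+ h => E2. by field; rewrite D0 E2.
  rewrite postN_s// natrM natrX exprS; field; by rewrite D0 E2.
- by apply: allpairs_uniq => //; [exact: index_enum_uniq|move=> [? ?] [? ?] _ _ [-> ->]].
- move=> [y t] nyt; rewrite rmatch0_law// /mprob; case: andP => [[yl _]|_].
    case/negP: nyt; apply/allpairsP; exists (y, t); split=> //=.
    by rewrite mem_index_enum.
  by rewrite mul0r mul0r.
- by apply: measurable_funX; apply: measurable_funB => //; exact: measurable_cst.
- by move=> w; exact: sqr_ge0.
- by move=> p; exact: sqr_ge0.
have aV := @ae_atom _ _ _ P (word * {fset word} * bool * bool)%type V dV.
apply: filterS2 Yae aV => w [yl zy] P0.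
rewrite m_funE// /g /=; congr ((_ - _) ^+ 2).
apply: (@cond_exp_post _ _ _ P G hG _ V (pred1 (rmatch S 0 z w))
  (mprob R z (rmatch S 0 z w) / 256%:R)) => // t.
have vE x v : minimax T3 (outcome G v) x = value G x v by rewrite /value (gtreeE hG).
case: ifPn => [/agreeP tw|/agreeP tw].
  rewrite -(rmatch0_law t)//; congr (P _); apply/seteqP; split => w' /=.
    by rewrite VE /phi => -[[-> _ _] ->].
  case=> yE tE; split=> //; rewrite VE /phi /= yE; congr (_, _, _, _).
  by rewrite !vE !(value_leaf hG)// tE tw//= eqxx.
rewrite (_ : [set w' | _]%classic = set0) ?measure0//.
apply/seteqP; split => // w' /= [+ tE]; rewrite VE /phi => -[yE _].
by rewrite !vE yE !(value_leaf hG)// tE => tw'; apply: tw => x xl /= /eqP ->.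
Qed.

End FunctionS.

(** * Explored leaves carry all the information about the outcomes *)

Lemma ae_all_seq (R : realType) (d : measure_display) (Omega : measurableType d)
    (P : probability Omega R) (I : eqType) (s : seq I) (Q : I -> Omega -> Prop) :
  (forall i, i \in s -> {ae P, forall w, Q i w}) ->
  {ae P, forall w, forall i, i \in s -> Q i w}.
Proof.
elim: s => [|i s IH] h; first exact: aeW.
have hs : {ae P, forall w, forall j, j \in s -> Q j w}.
  by apply: IH => j js; apply: h; rewrite inE js orbT.
apply: filterS2 (h i (mem_head _ _)) hs => w Qi Qs j.
by rewrite inE => /orP[/eqP ->|/Qs].
Qed.

Lemma measure_ae_iff (R : realType) (d : measure_display) (Omega : measurableType d)
    (P : probability Omega R) (A B : set Omega) : measurable A -> measurable B ->
  {ae P, forall w, A w <-> B w} -> P A = P B.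
Proof.
move=> mA mB AB.
rewrite -[LHS](_ : (\int[P]_w (\1_A w)%:E)%E = _); last by rewrite integral_indic// setIT.
rewrite -[RHS](_ : (\int[P]_w (\1_B w)%:E)%E = _); last by rewrite integral_indic// setIT.
apply: ge0_ae_eq_integral => //.
- exact/measurable_EFinP/(@measurable_indic _ Omega R setT _ mA).
- exact/measurable_EFinP/(@measurable_indic _ Omega R setT _ mB).
apply: filterS AB => w AB _; rewrite !indicE; congr (_%:R)%:E; congr nat_of_bool.
by apply/idP/idP => /set_mem/AB/mem_set.
Qed.

Definition plays (s : seq (word * word)) : seq word :=
  foldl (fun xs p => rcons xs (if p.1 \in xs then p.1 else p.2)) [::] s.

Lemma plays_rcons s p : plays (rcons s p) =
  rcons (plays s) (if p.1 \in plays s then p.1 else p.2).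
Proof. by rewrite /plays foldl_rcons. Qed.

Lemma plays_take i s : {subset plays (take i s) <= plays s}.
Proof.
rewrite -{2}(cat_take_drop i s); elim/last_ind: (drop i s) => [|s' p IH] x.
  by rewrite cats0.
by move=> /IH; rewrite -rcons_cat plays_rcons mem_rcons inE => ->; rewrite orbT.
Qed.

(** Branches add only shorter prefixes, so the explored leaves can be read off B_X; this is how the
    filtration knows them. *)
Lemma leaf_Bset (X : {fset word}) x : {subset X <= leafs} ->
  (x \in X) = (x \in Bset X) && (size x == 3).
Proof.
move=> Xl; rewrite in_fset /=; apply/idP/andP => [xX|[]].
  split; last by rewrite size_leafs// Xl.
  apply/flatten_mapP; exists x => //; apply/mapP; exists (size x).
    by rewrite mem_iota /= ltnS.
  by rewrite take_size.
move=> /flatten_mapP[y yX /mapP[k]]; rewrite mem_iota /= add0n ltnS => ky ->.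
rewrite size_takel// => /eqP k3.
by rewrite k3 take_oversize// size_leafs// Xl.
Qed.

Section Filtration.
Context (R : realType) (d : measure_display) (Omega : measurableType d).
Variables (P : probability Omega R) (G : random_game Omega).
Hypothesis hG : binary_bernoulli_game P G 3.
Variable S : simulator P G.
Local Notation out := (out G).
Variable F : strategy R.
Hypothesis admF : admissible S F.

Lemma rmatch_ae n z : z \in nodes ->
  {ae P, forall w, rmatch S n z w \in leafs /\ desc z (rmatch S n z w)}.
Proof.
(* The law is known for the first [n.+1] matches jointly with the outcomes, so the atoms record them
   all, with [z] as common start. *)
move=> zn; pose Y w := (out w, [seq rmatch S i z w | i <- iota 0 n.+1]).
have dY : discrete Y.
  apply: discrete_pair; first exact: discrete_out.
  elim: (iota 0 n.+1) => [|i l IH] /=; first exact: discrete_cst.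
  apply: (@discrete_comp _ _ _ _ (fun p : word * seq word => p.1 :: p.2)
    (fun w => (rmatch S i z w, _))).
  by apply: discrete_pair => //; exact: discrete_rmatch.
have nthY w i : (i < n.+1)%N -> nth [::] (Y w).2 i = rmatch S i z w.
  by move=> ni; rewrite (nth_map 0%N) ?size_iota// nth_iota.
have : {ae P, forall w, [set p | nth [::] p.2 n \in leafs /\
    desc z (nth [::] p.2 n)]%classic (Y w)}.
  apply: (ae_fibers dY) => -[t ys] /= nys.
  have := @sim_law _ _ _ _ _ hG S n.+1 t (fun=> z) (fun i => nth [::] ys i)
    (fun=> setT) (fun _ _ => zn) (fun=> measurableT).
  rewrite big_ord_recr /= [in X in (_ * (_ * (X * _)))%E]/mprob.
  case: andP => [//|_]; rewrite mul0r mul0e mule0 mule0 => h.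
  apply: (subset_measure0 _ _ _ h); first exact: (discrete_fiber (t, ys) dY).
    rewrite (_ : [set w | _]%classic = Y @^-1` [set p | p.1 = t /\
      forall i, (i < n.+1)%N -> nth [::] p.2 i = nth [::] ys i]%classic); first exact: dY.
    by apply/seteqP; split => w /= -[tE h']; split=> // i ni; have := h' i ni;
      rewrite nthY// => -[].
  by move=> w /= [tE <-]; split=> // i ni; split=> //; rewrite -nthY.
by apply: filterS => w /=; rewrite nthY.
Qed.

Definition good n w := forall i z, (i < n)%N -> z \in nodes ->
  rmatch S i z w \in leafs /\ desc z (rmatch S i z w).

Lemma good_ae n : {ae P, forall w, good n w}.
Proof.
have : {ae P, forall w, forall i, i \in iota 0 n -> forall z, z \in nodes ->
    rmatch S i z w \in leafs /\ desc z (rmatch S i z w)}.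
  by apply: ae_all_seq => i _; apply: ae_all_seq => z zn; exact: rmatch_ae.
by apply: filterS => w h i z ni zn; apply: h; rewrite ?mem_iota.
Qed.

Definition start n (xs : seq word) w : word :=
  if n == 0%N then [::] else choice_of S F n [fset x in xs] w.

(** Unlike [play], it keeps the starting nodes: once they are prescribed, a history is an event
    about matches from fixed nodes and the variables [unif], to which the law of the simulator
    applies. *)
Fixpoint transcript n w : seq (word * word) :=
  if n is k.+1 then
    let s := transcript k w in
    let z := start k (plays s) w in rcons s (z, rmatch S k z w)
  else [::].

Lemma play_transcript n w : play S F n w = plays (transcript n w).
Proof. by elim: n => //= n IH; rewrite plays_rcons /= -IH. Qed.

Lemma playS n w : play S F n.+1 w = let z := start n (play S F n w) w in
  rcons (play S F n w) (if z \in play S F n w then z else rmatch S n z w).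
Proof. by []. Qed.

Lemma good_play n w : good n w -> {subset play S F n w <= leafs}.
Proof.
elim: n => [//|n IH] gw; have {}IH : {subset play S F n w <= leafs}.
  by apply: IH => i z ni; apply: gw; exact: ltnW.
rewrite playS => x; rewrite /= mem_rcons inE => /orP[/eqP ->|]; last exact: IH.
case: ifPn => [|_]; first exact: IH.
suff zn : start n (play S F n w) w \in nodes by case: (gw n _ (ltnSn n) zn).
rewrite /start; case: eqVneq => // n0.
have := admF.2 n w; rewrite lt0n n0 => /(_ isT).
rewrite in_fsetU => /orP[|].
  by rewrite (gtreeE hG) in_fset_filter mem_T3 => /andP[].
by rewrite in_fset /= => /IH/leafs_nodes.
Qed.

Lemma good_start n w : good n w -> start n (play S F n w) w \in nodes.
Proof.
move=> gw; rewrite /start; case: eqVneq => // n0.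
have := admF.2 n w; rewrite lt0n n0 => /(_ isT).
rewrite in_fsetU => /orP[|].
  by rewrite (gtreeE hG) in_fset_filter mem_T3 => /andP[].
by rewrite in_fset /= => /(good_play gw)/leafs_nodes.
Qed.

Let choice_set n (xs : seq word) (o : {fmap word -> bool}) (z : word) : set R :=
  [set u | (if n == 0%N then [::] else
    F (Bset [fset x in xs]) (Dset T3 [fset x in xs]) o.[& [fset x in xs]] u) = z]%classic.

Let m_choice_set n xs o z : measurable (choice_set n xs o z).
Proof.
rewrite /choice_set; case: (n == 0%N); last exact: admF.1.
by have [->|nz] := pselect ([::] = z);
  [rewrite (_ : [set _ | _]%classic = setT)|rewrite (_ : [set _ | _]%classic = set0)];
  rewrite // ; apply/seteqP; split.
Qed.

Lemma startE n xs w : start n xs w =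
  if n == 0%N then [::] else F (Bset [fset x in xs]) (Dset T3 [fset x in xs])
    (outcome G w).[& [fset x in xs]] (unif S n w).
Proof. by rewrite /start /choice_of (gtreeE hG). Qed.

Lemma discrete_start n xs : discrete (start n xs).
Proof.
pose Z (o : {fmap word -> bool}) w := if n == 0%N then [::] else
  F (Bset [fset x in xs]) (Dset T3 [fset x in xs]) o.[& [fset x in xs]] (unif S n w).
rewrite (_ : start n xs = fun w => Z (outcome G w) w); last first.
  by apply/funext => w; rewrite startE.
apply: discrete_bind; first exact: discrete_outcome.
move=> o; apply: discrete_count => z.
rewrite -[X in measurable X](setTI (unif S n @^-1` choice_set n xs o z)).
exact: measurable_unif.
Qed.

Lemma discrete_transcript n : discrete (transcript n).
Proof.
elim: n => [|n IH]; first exact: discrete_cst.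
pose Z s w := rcons s (start n (plays s) w, rmatch S n (start n (plays s) w) w).
rewrite (_ : transcript n.+1 = fun w => Z (transcript n w) w)//.
apply: discrete_bind => // s.
apply: (@discrete_comp _ _ _ _ (fun p => rcons s p)
  (fun w => (start n (plays s) w, rmatch S n (start n (plays s) w) w))).
apply: (discrete_bind (Y := start n (plays s)) (Z := fun z w => (z, rmatch S n z w))).
  exact: discrete_start.
move=> z; apply: (@discrete_comp _ _ _ _ (pair z)).
exact: discrete_rmatch.
Qed.

(** Prescribing the whole history makes the past of each step known, so the event splits into one
    condition per step on the match and the uniform variable. *)
Lemma transcriptP n s w : size s = n ->
  transcript n w = s <-> forall i, (i < n)%N ->
    rmatch S i (nth ([::], [::]) s i).1 w = (nth ([::], [::]) s i).2 /\
    choice_set i (plays (take i s)) (outcome G w) (nth ([::], [::]) s i).1 (unif S i w).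
Proof.
elim: n s => [|n IH] s; first by move/size0nil => ->.
case/lastP: s => [//|s [z y]]; rewrite size_rcons => -[sn].
have tk i : (i < n)%N -> take i (rcons s (z, y)) = take i s.
  by move=> ni; rewrite -cats1 takel_cat// sn ltnW.
have tn : take n (rcons s (z, y)) = s by rewrite -cats1 take_size_cat.
split=> [/= /rcons_inj[ts zE yE] i|h /=].
  rewrite ltnS leq_eqVlt => /orP[/eqP ->|ni].
    rewrite nth_rcons sn ltnn eqxx tn /= /choice_set /= -startE -zE -yE ts.
    by rewrite -ts in zE *; rewrite zE.
  by rewrite nth_rcons sn ni tk//; move/(IH _ sn): ts; apply.
have ts : transcript n w = s.
  apply/IH => // i ni; have := h i (ltnW ni).
  by rewrite nth_rcons sn ni tk.
have := h n (ltnSn n); rewrite nth_rcons sn ltnn eqxx tn /= /choice_set /= -startE.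
by rewrite ts => -[yE zE]; rewrite zE yE.
Qed.

Lemma size_transcript n w : size (transcript n w) = n.
Proof. by elim: n => //= n IH; rewrite size_rcons IH. Qed.

Lemma good_transcript n w : good n w ->
  all (fun p => p.1 \in nodes) (transcript n w).
Proof.
elim: n => //= n IH gw; have {}gw' : good n w.
  by move=> i z ni; apply: gw; exact: ltnW.
by rewrite all_rcons IH// andbT -play_transcript; exact: good_start.
Qed.

Lemma m_out_transcript n (t : outs) s :
  measurable [set w | out w = t /\ transcript n w = s]%classic.
Proof.
rewrite (_ : [set w | _]%classic = [set w | (out w, transcript n w) = (t, s)]%classic).
  by apply: discrete_fiber; apply: discrete_pair;
    [exact: discrete_out|exact: discrete_transcript].
by apply/seteqP; split => w /=; [case=> -> ->|case=> -> ->].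
Qed.

(** The strategy reads outcomes only at leaves already explored, so each factor of the law is the
    same for both vectors. Histories of the wrong length, or with a start outside the tree, have
    probability 0 on both sides. *)
Lemma P_transcript_agree n s (t t' : outs) :
  {in leafs, forall x, x \in plays s -> ev t x = ev t' x} ->
  P [set w | out w = t /\ transcript n w = s]%classic =
  P [set w | out w = t' /\ transcript n w = s]%classic.
Proof.
move=> tt'; have [sn|/eqP sn] := eqVneq (size s) n; last first.
  have e u : [set w | out w = u /\ transcript n w = s]%classic = set0.
    apply/seteqP; split=> // w /= [_ ws]; apply: sn.
    by rewrite -ws size_transcript.
  by rewrite !e.
have [zn|/negP zn] := boolP (all (fun p => p.1 \in nodes) s); last first.
  have e u : P [set w | out w = u /\ transcript n w = s]%classic = 0%E.
    rewrite -(measure0 P); apply: measure_ae_iff => //; first exact: m_out_transcript.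
    apply: filterS (good_ae n) => w /good_transcript gw; split=> //= -[_ ws].
    by apply: zn; rewrite -ws.
  by rewrite !e.
pose z i := (nth ([::], [::]) s i).1; pose y i := (nth ([::], [::]) s i).2.
have znn i : (i < n)%N -> z i \in nodes.
  by move=> ni; move/all_nthP: zn; apply; rewrite sn.
have law u : P [set w | out w = u /\ transcript n w = s]%classic =
  ((256%:R^-1)%:E * \prod_(i < n) ((mprob R (z i) (y i))%:E *
     uniform_prob (@ltr01 R) (choice_set i (plays (take i s)) (fm u) (z i))))%E.
  rewrite -(@sim_law _ _ _ _ _ hG S n u z y (fun i => choice_set i (plays (take i s)) (fm u) (z i))
    znn (fun i => m_choice_set _ _ _ _)); congr (P _); apply/seteqP; split=> w /= [tE h]; split=> //.
    by rewrite -tE -(outcomeE hG); apply/transcriptP.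
  by apply/transcriptP => //; rewrite (outcomeE hG) tE.
rewrite !law; apply: (congr1 (fun x => ((256%:R^-1)%:E * x)%E)).
apply: eq_bigr => i _; apply: (congr1 (fun B => (_ * uniform_prob (@ltr01 R) B)%E)).
rewrite /choice_set (_ : (fm t).[& _] = (fm t').[& [fset x in plays (take i s)]])//.
apply/fm_restrict => x xl; rewrite in_fset /= => /plays_take; exact: tt'.
Qed.

Lemma discrete_filtration n : discrete (fun w => (Bset (explored S F n w),
  Dset (gtree G w) (explored S F n w), (outcome G w).[& explored S F n w])).
Proof.
pose phi (p : seq (word * word) * {fmap word -> bool}) :
    ({fset word} * {fset word} * {fmap word -> bool})%type :=
  let X := [fset x in plays p.1] in (Bset X, Dset T3 X, p.2.[& X]).
rewrite (_ : (fun _ => _) = fun w => phi (transcript n w, outcome G w)); last first.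
  by apply/funext => w; rewrite /phi /explored play_transcript (gtreeE hG).
apply: (discrete_comp phi); apply: discrete_pair; first exact: discrete_transcript.
exact: discrete_outcome.
Qed.

Lemma cond_exp_filtration n :
  {ae P, forall w, cond_exp P (filtration S F n) (fun v => (value G [::] v)%:R) w =
    post R 3 (mem (play S F n w)) (ev (out w)) [::]}.
Proof.
pose V w := (Bset (explored S F n w), Dset (gtree G w) (explored S F n w),
  (outcome G w).[& explored S F n w]).
have dV : discrete (V : Omega -> ({fset word} * {fset word} * {fmap word -> bool})%type).
  exact: discrete_filtration.
apply: filterS2 (good_ae n) (ae_atom P dV) => w gw P0.
(* [C] collects the histories that explore the same leaves, in any order and from any starts; [k] is
   their probability jointly with the true vector. *)
pose C := [set s | plays s =i play S F n w]%classic.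
pose k := fine (P ([set w' | out w' = out w] `&` transcript n @^-1` C)%classic).
apply: (@cond_exp_post _ _ _ P G hG _ V (mem (play S F n w)) k) => // t.
have mt (u : outs) : measurable [set w' | out w' = u]%classic.
  exact: (discrete_fiber u (discrete_out G)).
have mC := discrete_transcript n C.
transitivity (P [set w' | transcript n w' \in C /\ agree (mem (play S F n w)) t (out w)
    /\ out w' = t]%classic).
  apply: measure_ae_iff.
  - rewrite (_ : [set w' | _]%classic = [set w' | (V w', out w') = (V w, t)]%classic).
      by apply: discrete_fiber; apply: discrete_pair => //; exact: discrete_out.
    apply/seteqP; split => w' /=; first by case=> -> ->.
    by move=> h; split; [exact: (congr1 fst h)|exact: (congr1 snd h)].
  - have mD := discrete_fiber (true, t) (discrete_pair
      (discrete_comp (fun s => s \in C) (discrete_transcript n)) (discrete_out G)).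
    have [tw|ntw] := boolP (agree (mem (play S F n w)) t (out w)).
      rewrite (_ : [set w' | _]%classic =
        [set w' | (transcript n w' \in C, out w') = (true, t)]%classic)//.
      by apply/seteqP; split => w' /=; [case=> -> [_ ->]|case=> -> ->].
    rewrite (_ : [set w' | _]%classic = set0)//.
    by apply/seteqP; split=> // w' /= [_ []].
  (* Recovering the explored set from its branches needs it to consist of leaves, hence an
     equivalence up to a null set only. *)
  apply: filterS (good_ae n) => w' gw'.
  have eX (u : Omega) : good n u -> forall x, (x \in play S F n u) =
      (x \in Bset (explored S F n u)) && (size x == 3).
    move=> gu x; rewrite -leaf_Bset ?in_fset// => y; rewrite in_fset.
    exact: good_play.
  split=> [[Vw' tE]|/= [/set_mem sC [tw tE]]].
    have [VB _ VO] : [/\ Bset (explored S F n w') = Bset (explored S F n w),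
        Dset (gtree G w') (explored S F n w') = Dset (gtree G w) (explored S F n w) &
        (outcome G w').[& explored S F n w'] = (outcome G w).[& explored S F n w]].
      split; [exact: (congr1 (fun p => p.1.1) Vw')|
        exact: (congr1 (fun p => p.1.2) Vw')|exact: (congr1 snd Vw')].
    have pE : play S F n w' =i play S F n w by move=> x; rewrite (eX w' gw') (eX w gw) VB.
    split; first by apply/mem_set => x; rewrite -play_transcript; exact: pE.
    split=> //; apply/agreeP => x xl xw.
    have xe : explored S F n w' = explored S F n w.
      by apply/fsetP => y; rewrite !in_fset /= pE.
    move: VO; rewrite !(outcomeE hG) xe tE => /fm_restrict; apply=> //.
    by rewrite in_fset.
  split=> //.
  have xe : explored S F n w' = explored S F n w.
    by apply/fsetP => y; rewrite !in_fset /= play_transcript sC.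
  rewrite /V xe !(gtreeE hG) !(outcomeE hG) tE; congr (_, _, _).
  apply/fm_restrict => x xl; rewrite in_fset /= => xw.
  exact: (agreeP _ _ _ tw).
case: ifPn => [tw|ntw]; last first.
  rewrite (_ : [set w' | _]%classic = set0) ?measure0//.
  by apply/seteqP; split=> // w' /= [_ [tw _]]; move/negP: ntw.
rewrite /k fineK ?fin_num_measure//; last exact: measurableI.
transitivity (P ([set w' | out w' = t] `&` transcript n @^-1` C)%classic).
  congr (P _); apply/seteqP; split=> w' /=; first by case=> /set_mem ? [].
  by case=> tE sC; split; [exact/mem_set|split].
apply: measure_fibers => //; first exact: discrete_transcript.
move=> s sC; apply: P_transcript_agree => x xl.
rewrite sC => xw; exact: (agreeP _ _ _ tw).
Qed.

End Filtration.

(** * The step-by-step algorithm, computed with integers *)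

(* All the quantities attached to a node of height [h] are multiples of the
   inverse of [den h] (for R_n and U_n) or of its square (for Z_n).  The last
   branch of [RcN] is that of a leaf which is neither explored nor discovered:
   there the backward induction for R_n is an empty product. *)
Fixpoint RcN (h : nat) (xs : seq word) (o : word -> bool) (x : word) : nat :=
  if x \in xs then (o x * den h)%N else
  if x \in dset xs then mN h else
  if h is j.+1 then
    if max_node x then
      (den h - (den j - RcN j xs o (rcons x 1)) * (den j - RcN j xs o (rcons x 2)))%N
    else (RcN j xs o (rcons x 1) * RcN j xs o (rcons x 2))%N
  else den h.

(** The letters are 1 and 2, and [3 - i] exchanges them. *)
Definition sib (x : word) : word := rcons (father x) (3 - last 0 x)%N.

Definition UcN (h : nat) (xs : seq word) (o : word -> bool) (x : word) : nat :=
  if max_node (father x) then (den h - RcN h xs o (sib x))%N else RcN h xs o (sib x).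

Fixpoint ZcN (h : nat) (xs : seq word) (o : word -> bool) (x : word) : nat :=
  if x \in xs then 0%N else
  if x \in dset xs then sN h else
  if h is j.+1 then
    maxn (UcN j xs o (rcons x 1) ^ 2 * ZcN j xs o (rcons x 1))
         (UcN j xs o (rcons x 2) ^ 2 * ZcN j xs o (rcons x 2))
  else 0%N.

Definition keyN h xs o x : nat := (UcN h xs o x ^ 2 * ZcN h xs o x)%N.

(** A tie gives [None], so that an answer [Some c] certifies that every descent ends at [c]. *)
Fixpoint descN (h : nat) (xs : seq word) (o : word -> bool) (x : word) : option word :=
  if (x \in xs) || (x \in dset xs) then Some x else
  if h is j.+1 then
    if (keyN j xs o (rcons x 1) < keyN j xs o (rcons x 2))%N then
      descN j xs o (rcons x 2)
    else if (keyN j xs o (rcons x 2) < keyN j xs o (rcons x 1))%N then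
      descN j xs o (rcons x 1)
    else None
  else None.

Lemma brothers_T3 x : x \in nodes -> (0 < size x)%N ->
  sib x \in nodes /\ perm_eq (enum_fset (brothers T3 x)) [:: sib x].
Proof.
move=> xn x0; have sn : sib x \in nodes.
  have := all_nodes (p := fun x => (0 < size x)%N ==> (sib x \in nodes))
    ltac:(by vm_compute) xn.
  by rewrite x0.
split=> //; apply: uniq_perm => //.
move=> y; rewrite in_fset_filter mem_T3 mem_seq1.
apply/andP/eqP => [[yn xy]|->].
  have := all_nodes2 (p := fun x y => brother x y ==> (y == sib x))
    ltac:(by vm_compute) xn yn.
  by rewrite xy => /eqP.
split=> //; have := all_nodes (p := fun x => (0 < size x)%N ==> brother x (sib x))
  ltac:(by vm_compute) xn.
by rewrite x0.
Qed.

Lemma size_sib x : (0 < size x)%N -> size (sib x) = size x.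
Proof.
by move=> x0; rewrite /sib size_rcons /father size_takel ?leq_pred// prednK.
Qed.

Lemma dset_nodes xs x : x \in dset xs -> x \in nodes /\ (0 < size x)%N.
Proof.
rewrite mem_filter => /andP[/andP[/hasP[y _ yx] _] xn]; split=> //.
by case: x yx {xn} => //; rewrite /brother /child andbF.
Qed.

Lemma mN_le h : (mN h <= den h)%N.
Proof. by case: h => [|[|[|h]]]//; rewrite /mN nth_default. Qed.

Lemma RcN_le h xs o x : (RcN h xs o x <= den h)%N.
Proof.
elim: h x => [|h IH] x /=; case: ifP => _; first by case: (o x).
- by case: ifP.
- by case: (o x); rewrite ?mul1n.
case: ifP => _; first exact: (mN_le h.+1).
by case: ifP => _; [exact: leq_subr|exact: leq_mul].
Qed.

Section StepRule.
Context (R : realType) (d : measure_display) (Omega : measurableType d).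
Variables (P : probability Omega R) (G : random_game Omega).
Hypothesis hG : binary_bernoulli_game P G 3.
Variable S : simulator P G.
Variables (X : {fset word}) (xs : seq word) (o : word -> bool) (w : Omega).
Hypothesis Xxs : X =i xs.
Hypothesis val_xs : forall x, x \in xs -> value G x w = o x.

Let den0 h : (den h)%:R != 0 :> R. Proof. by rewrite pnatr_eq0 -lt0n den_gt0. Qed.

Let DE x : (x \in Dset (gtree G w) X) = (x \in dset xs).
Proof. by rewrite (gtreeE hG); exact: Dset_mem. Qed.

Let heightE h (x : word) : (size x + h = 3)%N -> (3 - size x)%N = h.
Proof. by move=> <-; rewrite addKn. Qed.

Let leaf_children x : x \in nodes -> size x = 3%N ->
  enum_fset (children (gtree G w) x) = [::].
Proof.
move=> xn x3; apply/eqP; rewrite -size_eq0 -[size _]/(#|` _|) cardfs_eq0.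
apply/eqP/fsetP => y; rewrite (gtreeE hG) in_fset_filter mem_T3 in_fset0.
by apply/negP => /andP[yn]; rewrite child_kids// x3 ltnn andbF.
Qed.

(** The fuel must exceed the height: a leaf that is neither explored nor discovered gets the empty
    product 1 if fuel is left, and 0 otherwise. *)
Lemma Rn_recE h k x : x \in nodes -> (size x + h = 3)%N -> (h < k)%N ->
  Rn_rec P G X w k x = (RcN h xs o x)%:R / (den h)%:R.
Proof.
have known z j (v : R) (v' : nat) : z \in nodes -> (size z + j = 3)%N ->
    v = v'%:R / (den j)%:R ->
    (if z \in X then (value G z w)%:R else
     if z \in Dset (gtree G w) X then m_fun P G (Kset (gtree G w) z) z else v)
    = (if z \in xs then o z * den j else if z \in dset xs then mN j else v')%N%:R
      / (den j)%:R.
  move=> zn zj vv'; rewrite Xxs DE; case: ifP => [zx|_].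
    by rewrite val_xs// natrM mulfK.
  case: ifP => [/dset_nodes[_ z0]|//].
  by rewrite (gtreeE hG) m_funE// (heightE zj) postE -(heightE zj) postN_m.
elim: h k x => [|h IH] [//|k] x xn xh hk /=; apply: known => //.
  have x3 : size x = 3%N by rewrite -xh addn0.
  by rewrite leaf_children// !big_nil /max_node x3 /= divff.
have x3 := inner_lt xh.
have [n1 h1] := kid1_nodes xn xh; have [n2 h2] := kid2_nodes xn xh.
rewrite (gtreeE hG) !(perm_big _ (children_T3 xn x3)) /= !big_cons !big_nil !mulr1.
rewrite !IH//; case: ifP => _; last by rewrite !natrM invfM mulrACA.
rewrite natrB; last by apply: leq_mul; exact: leq_subr.
rewrite !natrM !natrB ?RcN_le//; move: (den0 h); set D := (den h)%:R => D0.
by field.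
Qed.

Lemma RnE h x : x \in nodes -> (size x + h = 3)%N ->
  Rn P G X w x = (RcN h xs o x)%:R / (den h)%:R.
Proof.
move=> xn xh; apply: Rn_recE => //.
by rewrite (gtreeE hG) card_T3 ltnS -(heightE xh) (leq_trans (leq_subr _ _)).
Qed.

Lemma UnE h x : x \in nodes -> (0 < size x)%N -> (size x + h = 3)%N ->
  Un P G X w x = (UcN h xs o x)%:R / (den h)%:R.
Proof.
move=> xn x0 xh; have [sn ps] := brothers_T3 xn x0.
have sh : (size (sib x) + h = 3)%N by rewrite size_sib.
rewrite /Un /UcN (gtreeE hG) !(perm_big _ ps) /= !big_cons !big_nil !mulr1.
rewrite !(RnE sn sh); case: ifP => // _.
by rewrite natrB ?RcN_le// mulrBl divff.
Qed.

Lemma Zn_recE h k x : x \in nodes -> (size x + h = 3)%N -> (h < k)%N ->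
  Zn_rec S X w k x = (ZcN h xs o x)%:R / (den h)%:R ^+ 2.
Proof.
have known z j (v : R) (v' : nat) : z \in nodes -> (size z + j = 3)%N ->
    v = v'%:R / (den j)%:R ^+ 2 ->
    (if z \in X then 0 else
     if z \in Dset (gtree G w) X then s_fun S (Kset (gtree G w) z) z else v)
    = (if z \in xs then 0 else if z \in dset xs then sN j else v')%N%:R
      / (den j)%:R ^+ 2.
  move=> zn zj vv'; rewrite Xxs DE; case: ifP => [zx|_]; first by rewrite mul0r.
  case: ifP => [/dset_nodes[_ z0]|//].
  by rewrite (gtreeE hG) (s_funE hG)// (heightE zj).
elim: h k x => [|h IH] [//|k] x xn xh hk /=; apply: known => //.
  by rewrite leaf_children ?big_nil ?mul0r// -xh addn0.
have x3 := inner_lt xh.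
have [n1 h1] := kid1_nodes xn xh; have [n2 h2] := kid2_nodes xn xh.
rewrite (gtreeE hG) !(perm_big _ (children_T3 xn x3)) /= !big_cons !big_nil.
have p (i : nat) : (0 < size (rcons x i))%N by rewrite size_rcons.
rewrite !IH// (UnE n1 (p _) h1) (UnE n2 (p _) h2).
have e (a b : nat) : (a%:R / (den h)%:R) ^+ 2 * (b%:R / (den h)%:R ^+ 2) =
    (a ^ 2 * b)%N%:R / (den h * den h)%N%:R ^+ 2 :> R.
  move: (den0 h); rewrite !natrM ?natrX; set D := (den h)%:R => D0; by field.
rewrite !e natr_max.
have D2 : 0 < (den h * den h)%N%:R ^+ 2 :> R.
  by rewrite exprn_gt0// ltr0n muln_gt0 den_gt0.
rewrite [Num.max _ 0]max_l ?divr_ge0 ?ler0n ?(ltW D2)//.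
by rewrite maxr_pMl// invr_ge0 ltW.
Qed.

Lemma ZnE h x : x \in nodes -> (size x + h = 3)%N ->
  Zn S X w x = (ZcN h xs o x)%:R / (den h)%:R ^+ 2.
Proof.
move=> xn xh; apply: Zn_recE => //.
by rewrite (gtreeE hG) card_T3 ltnS -(heightE xh) (leq_trans (leq_subr _ _)).
Qed.

Lemma keyE h x : x \in nodes -> (0 < size x)%N -> (size x + h = 3)%N ->
  Un P G X w x ^+ 2 * Zn S X w x = (keyN h xs o x)%:R / (den h)%:R ^+ 4.
Proof.
move=> xn x0 xh; rewrite (UnE xn x0 xh) (ZnE xn xh) /keyN !natrM ?natrX.
move: (den0 h); set D := (den h)%:R => D0; by field.
Qed.

(** A strict inequality between the two keys contradicts the maximality of the other child, so any
    descent follows the computed one. *)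
Lemma descentE h x z c : x \in nodes -> (size x + h = 3)%N ->
  descent S X w x z -> descN h xs o x = Some c -> z = c.
Proof.
move=> xn xh dz; elim: dz h c xn xh => {x z} [x|x y z].
  rewrite in_fsetU Xxs DE => xX [|h] c _ _ /=; rewrite xX; by case.
rewrite in_fsetU Xxs DE => /negbTE nx [yc ym] _ IH [|h] c xn xh /=; rewrite nx //.
have x3 := inner_lt xh.
have [n1 h1] := kid1_nodes xn xh; have [n2 h2] := kid2_nodes xn xh.
have cE : children (gtree G w) x =i kids x.
  by rewrite (gtreeE hG); exact: perm_mem (children_T3 xn x3).
have key_le i j : rcons x i \in kids x -> rcons x j \in kids x ->
    y = rcons x i -> (keyN h xs o (rcons x j) <= keyN h xs o (rcons x i))%N.
  move=> ik jk yi; have kn := kids_nodes xn x3.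
  have hh l : (size (rcons x l) + h = 3)%N by rewrite size_rcons addSnnS.
  have := ym (rcons x j); rewrite cE jk => /(_ isT).
  have p (l : nat) : (0 < size (rcons x l))%N by rewrite size_rcons.
  rewrite yi (keyE (kn _ jk) (p _) (hh _)) (keyE (kn _ ik) (p _) (hh _)).
  by rewrite ler_pM2r ?ler_nat// invr_gt0 exprn_gt0// ltr0n den_gt0.
have k1 : rcons x 1%N \in kids x by rewrite mem_head.
have k2 : rcons x 2%N \in kids x by rewrite !inE eqxx orbT.
move: (yc); rewrite cE !inE => /orP[/eqP yE|/eqP yE].
  have := key_le 1%N 2%N k1 k2 yE; rewrite leqNgt => /negbTE ->.
  by case: ifP => // _; rewrite -yE; apply: IH; rewrite yE.
case: ifP => _; first by rewrite -yE; apply: IH; rewrite yE.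
by have := key_le 2%N 1%N k2 k1 yE; rewrite leqNgt => /negbTE ->.
Qed.

(** The bounds on the numerator, over [den 3], exclude that R_n(r) is 0 or 1, hence the freedom to
    stop. *)
Lemma step_ruleE z c : step_rule S X w z -> descN 3 xs o [::] = Some c ->
  (0 < RcN 3 xs o [::] < 256)%N -> z = c.
Proof.
move=> [dz|[r01 _]] dc /andP[r0 r1]; first exact: descentE dz dc.
have Rr : Rn P G X w [::] = (RcN 3 xs o [::])%:R / 256%:R by exact: RnE.
exfalso; move: r01; rewrite Rr => -[/eqP|/eqP].
  by rewrite mulf_eq0 invr_eq0 !pnatr_eq0 orbF eqn0Ngt r0.
rewrite -subr_eq0 -[X in _ - X](@divff _ 256%:R) ?pnatr_eq0// -mulrBl.
rewrite mulf_eq0 invr_eq0 pnatr_eq0 orbF subr_eq0 eqr_nat => /eqP e.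
by rewrite e ltnn in r1.
Qed.

End StepRule.

(** * Two strategies and their errors *)

Definition uncle (x : word) : word := sib (father x).
Definition granduncle (x : word) : word := sib (father (father x)).

(** Makes the choice a node for arbitrary words, so that the law of the simulator applies even to
    matches that might not end at leaves. *)
Definition nd (z : word) : word := if z \in nodes then z else [::].

Definition bit2 (x1 : word) (b1 b2 : bool) : word -> bool :=
  fun y => if y == x1 then b1 else b2.

(* The choices of the step-by-step algorithm.  When [b1] and [b2] are both
   true the root has value 1 and the value of [step2] is irrelevant. *)
Definition step1 x (b : bool) : word := nd (if b then uncle x else sib x).
Definition step2 x1 (b1 : bool) x2 (b2 : bool) : word :=
  nd (if b1 then sib x2 else if b2 then uncle x1 else granduncle x1).

(* The better strategy: after a first leaf of value 0 it leaves the current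
   half of the tree instead of visiting the brother of this leaf. *)
Definition altsel (xs : seq word) (o : word -> bool) : word :=
  match xs with
  | [:: x] => if o x then uncle x else granduncle x
  | [:: x; y] =>
      if head 0%N x == head 0%N y then sib (if o x then y else x)
      else if o x then uncle x else if o y then uncle y else sib x
  | _ => [::]
  end.

Definition alt1 x (b : bool) : word := nd (altsel [:: x] (fun=> b)).
(** A strategy sees the set of explored leaves but not their order, so the two leaves are listed in
    the order of [leafs]. *)
Definition alt2 x1 (b1 : bool) x2 (b2 : bool) : word :=
  nd (altsel [seq x <- leafs | x \in [:: x1; x2]] (bit2 x1 b1 b2)).

Fixpoint bits (n : nat) : seq (seq bool) :=
  if n is k.+1 then [seq b :: s | b <- [:: true; false], s <- bits k] else [:: [::]].

Definition sumN T (f : T -> N) (l : seq T) : N := foldr (fun x a => N.add (f x) a) N0 l.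

Definition sqN (xs : seq word) (s : seq bool) : N :=
  let a := postN 3 (mem xs) (ev s) [::] in
  let b := (256 * mval (ev s) [::])%N in
  let e := N.of_nat (a - b + (b - a)) in N.mul e e.

(** A match from a node z reaches a given leaf below it with probability 2^|z|/8; the powers of 8 go
    to the denominator. *)
Definition err2N (c1 : word -> bool -> word) : N :=
  sumN (fun s => sumN (fun x1 =>
    let z1 := c1 x1 (ev s x1) in
    N.mul (N.of_nat (2 ^ size z1))
      (sumN (fun x2 => sqN [:: x1; x2] s) [seq x2 <- leafs | desc z1 x2])) leafs) (bits 8).

Definition err3N (c1 : word -> bool -> word) (c2 : word -> bool -> word -> bool -> word) : N :=
  sumN (fun s => sumN (fun x1 =>
    let z1 := c1 x1 (ev s x1) in
    N.mul (N.of_nat (2 ^ size z1))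
      (sumN (fun x2 =>
        let z2 := c2 x1 (ev s x1) x2 (ev s x2) in
        N.mul (N.of_nat (2 ^ size z2))
          (sumN (fun x3 => sqN [:: x1; x2; x3] s) [seq x3 <- leafs | desc z2 x3]))
        [seq x2 <- leafs | desc z1 x2])) leafs) (bits 8).

Lemma nd_nodes z : nd z \in nodes.
Proof. by rewrite /nd; case: ifP. Qed.

Lemma step1_check x1 b1 : x1 \in leafs ->
  descN 3 [:: x1] (fun=> b1) [::] = Some (step1 x1 b1) /\
  (0 < RcN 3 [:: x1] (fun=> b1) [::] < 256)%N.
Proof.
move=> x1l; have /allP/(_ _ x1l)/allP/(_ b1) : all (fun x1 => all (fun b1 =>
    (descN 3 [:: x1] (fun=> b1) [::] == Some (step1 x1 b1)) &&
    (0 < RcN 3 [:: x1] (fun=> b1) [::] < 256)%N) [:: true; false]) leafs by vm_compute.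
by case: b1 => /(_ isT)/andP[/eqP].
Qed.

(** The second alternative covers two leaves of value 1 that decide the root; ties and stopping then
    leave the third choice open. *)
Lemma step2_check x1 b1 x2 b2 : x1 \in leafs -> x2 \in leafs -> desc (step1 x1 b1) x2 ->
  (descN 3 [:: x1; x2] (bit2 x1 b1 b2) [::] = Some (step2 x1 b1 x2 b2) /\
   (0 < RcN 3 [:: x1; x2] (bit2 x1 b1 b2) [::] < 256)%N) \/
  postN 3 (mem [:: x1; x2]) (bit2 x1 b1 b2) [::] = 256%N.
Proof.
move=> x1l x2l dx; have x2f : x2 \in [seq x2 <- leafs | desc (step1 x1 b1) x2].
  by rewrite mem_filter dx.
have /allP/(_ _ x1l)/allP/(_ b1) : all (fun x1 => all (fun b1 => all (fun x2 => all (fun b2 =>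
    (descN 3 [:: x1; x2] (bit2 x1 b1 b2) [::] == Some (step2 x1 b1 x2 b2)) &&
    (0 < RcN 3 [:: x1; x2] (bit2 x1 b1 b2) [::] < 256)%N ||
    (postN 3 (mem [:: x1; x2]) (bit2 x1 b1 b2) [::] == 256)%N) [:: true; false])
    [seq x2 <- leafs | desc (step1 x1 b1) x2]) [:: true; false]) leafs by vm_compute.
have b1s : b1 \in [:: true; false] by case: (b1).
have b2s : b2 \in [:: true; false] by case: (b2).
move=> /(_ b1s)/allP/(_ _ x2f)/allP/(_ _ b2s)/orP[/andP[/eqP ? ?]|/eqP ?].
  by left.
by right.
Qed.

Lemma alt1_check x1 b1 : x1 \in leafs -> altsel [:: x1] (fun=> b1) \in dset [:: x1].
Proof.
move=> x1l; have /allP/(_ _ x1l)/allP/(_ b1) : all (fun x1 => all (fun b1 =>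
    altsel [:: x1] (fun=> b1) \in dset [:: x1]) [:: true; false]) leafs by vm_compute.
by apply; case: b1.
Qed.

Lemma alt2_check x1 b1 x2 b2 : x1 \in leafs -> x2 \in leafs -> desc (alt1 x1 b1) x2 ->
  altsel [seq x <- leafs | x \in [:: x1; x2]] (bit2 x1 b1 b2) \in dset [:: x1; x2] \/
  postN 3 (mem [:: x1; x2]) (bit2 x1 b1 b2) [::] = 256%N.
Proof.
move=> x1l x2l dx; have x2f : x2 \in [seq x2 <- leafs | desc (alt1 x1 b1) x2].
  by rewrite mem_filter dx.
have /allP/(_ _ x1l)/allP/(_ b1) : all (fun x1 => all (fun b1 => all (fun x2 => all (fun b2 =>
    (altsel [seq x <- leafs | x \in [:: x1; x2]] (bit2 x1 b1 b2) \in dset [:: x1; x2]) ||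
    (postN 3 (mem [:: x1; x2]) (bit2 x1 b1 b2) [::] == 256)%N) [:: true; false])
    [seq x2 <- leafs | desc (alt1 x1 b1) x2]) [:: true; false]) leafs by vm_compute.
have b1s : b1 \in [:: true; false] by case: (b1).
have b2s : b2 \in [:: true; false] by case: (b2).
move=> /(_ b1s)/allP/(_ _ x2f)/allP/(_ _ b2s)/orP[?|/eqP ?]; first by left.
by right.
Qed.

Lemma nd_id z : z \in nodes -> nd z = z. Proof. by rewrite /nd => ->. Qed.

Lemma altsel_ext xs o o' : {in xs, o =1 o'} -> altsel xs o = altsel xs o'.
Proof.
case: xs => [|x [|y [|? ?]]]//= oo'; first by rewrite oo' ?mem_head.
by rewrite !oo' ?inE ?eqxx ?orbT.
Qed.

Lemma mem_bits n s : (s \in bits n) = (size s == n).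
Proof.
elim: n s => [|n IH] [|b s] //=.
  by apply/negP; rewrite !mem_cat => /orP[/mapP[]|/orP[/mapP[]|]].
rewrite eqSS -IH !mem_cat orbF; apply/orP/idP => [[]/mapP[s' s'b [_ ->]]//|sb].
by case: b; [left|right]; apply/mapP; exists s.
Qed.

Lemma sum_outs (R : realType) (f : seq bool -> R) :
  \sum_(t : outs) f t = \sum_(s <- bits 8) f s.
Proof.
rewrite -(big_map val xpredT f); apply: perm_big; apply: uniq_perm.
- by rewrite map_inj_uniq ?index_enum_uniq//; exact: val_inj.
- by vm_compute.
move=> s; rewrite mem_bits; apply/mapP/eqP => [[t _ ->]|sz]; first by rewrite size_tuple.
by exists (Tuple (introT eqP sz)) => //; exact: mem_index_enum.
Qed.

Lemma sumNE (R : realType) T (f : T -> N) (l : seq T) :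
  (N.to_nat (sumN f l))%:R = \sum_(x <- l) (N.to_nat (f x))%:R :> R.
Proof.
elim: l => [|x l IH]; first by rewrite big_nil.
by rewrite big_cons -IH /= N2Nat.inj_add plusE natrD.
Qed.

Lemma mulNE (R : realType) a b :
  (N.to_nat (N.mul (N.of_nat a) b))%:R = a%:R * (N.to_nat b)%:R :> R.
Proof. by rewrite N2Nat.inj_mul Nat2N.id multE natrM. Qed.

Lemma sqNE (R : realType) xs (s : seq bool) :
  (post R 3 (mem xs) (ev s) [::] - (mval (ev s) [::])%:R) ^+ 2 =
  (N.to_nat (sqN xs s))%:R / 256%:R ^+ 2.
Proof.
rewrite /sqN mulNE Nat2N.id postE; set a := postN _ _ _ _; set b := mval _ _.
have e : ((a - 256 * b + (256 * b - a))%N%:R : R) ^+ 2 = (a%:R - (256 * b)%N%:R) ^+ 2.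
  by rewrite -sqdE /sqd natrX.
rewrite -expr2 e natrM.
rewrite (_ : (den 3)%:R = 256%:R)//; by field.
Qed.

Lemma mprob_leaf (R : realType) z y : z \in nodes -> y \in leafs ->
  mprob R z y = (desc z y)%:R * ((2 ^ size z)%N%:R / 8%:R).
Proof.
move=> zn yl; rewrite /mprob yl /=; congr (_ * _).
have zs := nodes_size zn.
rewrite natrX (_ : 8%:R = 2%:R ^+ size z * 2%:R ^+ (3 - size z)).
  rewrite invfM mulrA divff ?mul1r// expf_neq0//.
by rewrite -exprD subnKC// -natrX.
Qed.

(** An average of zeros and ones equals 1 only if all of them are 1: every completion of the known
    outcomes gives the root value 1. Learning more outcomes preserves this, and the true vector is
    itself a completion. *)
Lemma post_mono (R : realType) (X X' : pred word) (t : outs) :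
  post R 3 X (ev t) [::] = 1 -> {in leafs, subpred X X'} ->
  post R 3 X' (ev t) [::] = 1 /\ mval (ev t) [::].
Proof.
move=> p1 XX'; have all1 (u : outs) : mm 3 (splice X (ev t) (ev u)) [::].
  have : \sum_(u : outs) (1 - (mm 3 (splice X (ev t) (ev u)) [::])%:R) = 0 :> R.
    apply: (@mulIf _ (256%:R^-1)); first by rewrite invr_eq0 pnatr_eq0.
    rewrite mul0r -/(avg _) avgB avg_const avg_splice// p1 subrr//.
  move/eqP; rewrite psumr_eq0 => [/allP/(_ u (mem_index_enum u))|v _].
    by case: (mm 3 _ _) => //=; rewrite subr0 oner_eq0.
  by case: (mm 3 _ _); rewrite ?subrr ?subr0.
split.
  rewrite -avg_splice// -[RHS](@avg_const R); apply: eq_avg => u.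
  rewrite (@mm_ext _ _ (splice X (ev t) (ev (tup (splice X' (ev t) (ev u))))))//.
    by rewrite all1.
  move=> y yl _; rewrite /splice ev_tup//; case: (boolP (X y)) => // Xy.
  by rewrite (XX' y yl Xy).
have := all1 t; rewrite /mval (@mm_ext _ _ (ev t))// => y yl _.
by rewrite /splice; case: ifP.
Qed.

(** * The mean square errors as finite sums *)

Section Errors.
Context (R : realType) (d : measure_display) (Omega : measurableType d).
Variables (P : probability Omega R) (G : random_game Omega).
Hypothesis hG : binary_bernoulli_game P G 3.
Variable S : simulator P G.
Local Notation out := (out G).
Variable F : strategy R.
Hypothesis admF : admissible S F.

(** A match from a leaf stays there, so repeating an explored leaf and simulating from it give the
    same list. *)
Lemma good_playS n w : good S n.+1 w -> play S F n.+1 w =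
  rcons (play S F n w) (rmatch S n (start S F n (play S F n w) w) w).
Proof.
move=> gw; have gw' : good S n w by move=> i z ni; apply: gw; exact: ltnW.
rewrite playS /=; case: ifPn => // zX; congr rcons.
have zn := good_start hG admF gw'; have [yl] := gw n _ (ltnSn n) zn.
by rewrite (desc_leafs (good_play hG admF gw' zX) yl) => /eqP.
Qed.

Lemma play1 w : play S F 1 w = [:: rmatch S 0 [::] w].
Proof. by []. Qed.

Lemma measurable_sq_error n : measurable_fun setT (fun w =>
  (cond_exp P (filtration S F n) (fun v => (value G [::] v)%:R) w -
   (value G [::] w)%:R) ^+ 2 : R).
Proof.
have mv : measurable_fun setT (fun v => (value G [::] v)%:R : R).
  rewrite (_ : (fun _ => _) = (fun t => (mval (ev t) [::])%:R : R) \o out).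
    exact: (measurable_out G (fun t => (mval (ev t) [::])%:R)).
  by apply/funext => v /=; rewrite (valueE hG).
apply: measurable_funX; apply: measurable_funB => //.
apply: (@cond_exp_measurable _ _ _ _ ({fset word} * {fset word} * {fmap word -> bool})%type) => //.
  exact: (discrete_filtration hG admF).
by move=> v; case: value; rewrite lexx ler01.
Qed.

Variables (c1 : word -> bool -> word) (c2 : word -> bool -> word -> bool -> word).
Hypothesis c1n : forall x b, c1 x b \in nodes.
Hypothesis c2n : forall x b y b', c2 x b y b' \in nodes.

Let x1 w := rmatch S 0 [::] w.
Let z1 w := c1 (x1 w) (ev (out w) (x1 w)).
Let x2 w := rmatch S 1 (z1 w) w.
Let z2 w := c2 (x1 w) (ev (out w) (x1 w)) (x2 w) (ev (out w) (x2 w)).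
Let x3 w := rmatch S 2 (z2 w) w.

Hypothesis start1 : forall w, good S 1 w -> start S F 1 [:: x1 w] w = z1 w.
(** Once the root is known to be 1 the third start may differ from [c2], since any third leaf then
    gives error 0. *)
Hypothesis start2 : forall w, good S 2 w ->
  start S F 2 [:: x1 w; x2 w] w = z2 w \/
  post R 3 (mem [:: x1 w; x2 w]) (ev (out w)) [::] = 1.

Let play2 w : good S 2 w -> play S F 2 w = [:: x1 w; x2 w].
Proof.
move=> gw; rewrite good_playS// play1 start1// => i z ni; apply: gw; exact: ltnW.
Qed.

Let play3 w : good S 3 w -> play S F 3 w = [:: x1 w; x2 w; x3 w] \/
  (post R 3 (mem [:: x1 w; x2 w]) (ev (out w)) [::] = 1 /\
   exists y, play S F 3 w = [:: x1 w; x2 w; y]).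
Proof.
move=> gw; have gw' : good S 2 w by move=> i z ni; apply: gw; exact: ltnW.
rewrite good_playS// play2//; have [->|?] := start2 gw'; [by left|right].
by split=> //; exists (rmatch S 2 (start S F 2 [:: x1 w; x2 w] w) w).
Qed.

Let p2 (y : outs * word * word) : R := let: (t, a, b) := y in
  256%:R^-1 * (mprob R [::] a * mprob R (c1 a (ev t a)) b).
Let p3 (y : outs * word * word * word) : R := let: (t, a, b, c) := y in
  256%:R^-1 * (mprob R [::] a * mprob R (c1 a (ev t a)) b *
    mprob R (c2 a (ev t a) b (ev t b)) c).

(** For prescribed [t], [a], [b] the second start is the fixed node [c1 a (ev t a)], so the law of
    the simulator applies although the start is random. *)
Let law2 y : P [set w | (out w, x1 w, x2 w) = y]%classic = (p2 y)%:E.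
Proof.
case: y => [[t a] b]; pose z := nth [::] [:: [::]; c1 a (ev t a)].
have zn i : (i < 2)%N -> z i \in nodes by case: i => [|[|]]// _; exact: c1n.
have := @sim_law _ _ _ _ _ hG S 2 t z (nth [::] [:: a; b]) (fun=> setT) zn
  (fun=> measurableT).
rewrite !big_ord_recr big_ord0 /= !probability_setT !mule1 mul1e -!EFinM => <-.
congr (P _); apply/seteqP; split => w /=.
  by case=> tE aE bE; rewrite -bE /x2 /z1 tE aE; split=> // -[|[|]].
case=> tE h; have [aE _] := h 0%N isT; have [bE _] := h 1%N isT.
by rewrite /x2 /z1 /x1 tE aE bE.
Qed.

Let law3 y : P [set w | (out w, x1 w, x2 w, x3 w) = y]%classic = (p3 y)%:E.
Proof.
case: y => [[[t a] b] c].
pose z := nth [::] [:: [::]; c1 a (ev t a); c2 a (ev t a) b (ev t b)].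
have zn i : (i < 3)%N -> z i \in nodes by case: i => [|[|[|]]]// _; [exact: c1n|exact: c2n].
have := @sim_law _ _ _ _ _ hG S 3 t z (nth [::] [:: a; b; c]) (fun=> setT) zn
  (fun=> measurableT).
rewrite !big_ord_recr big_ord0 /= !probability_setT !mule1 mul1e -!EFinM => <-.
congr (P _); apply/seteqP; split => w /=.
  case=> tE aE bE cE; split=> // -[|[|[|]]]// _; split=> //; rewrite /z /=.
    by rewrite -bE /x2 /z1 tE aE.
  by rewrite -cE /x3 /z2 tE aE bE.
case=> tE h; have [aE _] := h 0%N isT; have [bE _] := h 1%N isT; have [cE _] := h 2%N isT.
have b' : x2 w = b by rewrite /x2 /z1 /x1 tE aE.
by rewrite /x3 /z2 b' /x1 tE aE cE.
Qed.

Let discrete_x1 : discrete (fun w => (out w, x1 w)).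
Proof. by apply: discrete_pair; [exact: discrete_out|exact: discrete_rmatch]. Qed.

Let discrete_x2 : discrete (fun w => (out w, x1 w, x2 w)).
Proof.
apply: (discrete_bind (Y := fun w => (out w, x1 w))
  (Z := fun y w => (y, rmatch S 1 (c1 y.2 (ev y.1 y.2)) w))) => // y.
exact: (discrete_comp (pair y) (discrete_rmatch S 1 _)).
Qed.

Let discrete_x3 : discrete (fun w => (out w, x1 w, x2 w, x3 w)).
Proof.
apply: (discrete_bind (Y := fun w => (out w, x1 w, x2 w))
  (Z := fun y w => (y, rmatch S 2 (c2 y.1.2 (ev y.1.1 y.1.2) y.2 (ev y.1.1 y.2)) w))) => // y.
exact: (discrete_comp (pair y) (discrete_rmatch S 2 _)).
Qed.

Let mprob0 z y : y \notin leafs -> mprob R z y = 0.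
Proof. by rewrite /mprob => /negbTE ->; rewrite mul0r. Qed.

(** 256 counts the vectors, 64 is 8^2 for the two matches, and 256^2 is the squared denominator of
    [post] at the root. *)
Lemma mean_sq_error2 : mean_sq_error S F 2 =
  ((N.to_nat (err2N c1))%:R / (256%:R * 64%:R * 256%:R ^+ 2))%:E.
Proof.
rewrite /mean_sq_error unlock.
pose g (y : outs * word * word) : R := let: (t, a, b) := y in
  (post R 3 (mem [:: a; b]) (ev t) [::] - (mval (ev t) [::])%:R) ^+ 2.
rewrite (@ge0_integral_discrete _ _ _ P _ (fun w => (out w, x1 w, x2 w))
  [seq (y, b) | y <- [seq (t, a) | t <- index_enum outs, a <- leafs], b <- leafs] _ g)//.
- congr EFin; rewrite !big_allpairs /err2N sumNE -sum_outs mulr_suml.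
  apply: eq_bigr => t _; rewrite sumNE mulr_suml; apply: eq_big_seq => a al.
  rewrite mulNE sumNE big_filter [in RHS]big_mkcond mulr_sumr mulr_suml.
  apply: eq_big_seq => b bl; rewrite law2 [fine _]/(p2 _) /p2 /g sqNE.
  rewrite (mprob_leaf _ _ al)// (mprob_leaf _ (c1n _ _) bl).
  rewrite (_ : desc [::] a = true); last exact: prefix0s.
  rewrite (_ : 2 ^ size ([::] : word) = 1)%N//.
  move: (N.to_nat _) (2 ^ size _)%N => v m.
  case: (desc _ _); last by rewrite !(mul0r, mulr0).
  by rewrite (_ : true%:R = 1 :> R)//; field.
- apply: allpairs_uniq => //; last by move=> [? ?] [? ?] _ _ [-> ->].
  apply: allpairs_uniq => //; last by move=> [? ?] [? ?] _ _ [-> ->].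
  exact: index_enum_uniq.
- move=> [[t a] b] nin; rewrite law2 /p2.
  have [al|/mprob0 ->] := boolP (a \in leafs); last by rewrite mul0r mulr0.
  have [bl|/mprob0 ->] := boolP (b \in leafs); last by rewrite !mulr0.
  case/negP: nin; do 2 apply: (allpairs_f pair) => //; exact: mem_index_enum.
- exact: measurable_sq_error.
- by move=> w; exact: sqr_ge0.
- by move=> [[t a] b]; exact: sqr_ge0.
apply: filterS2 (good_ae hG S 2) (cond_exp_filtration hG admF 2) => w gw ->.
by rewrite /g (valueE hG)// play2.
Qed.

Lemma mean_sq_error3 : mean_sq_error S F 3 =
  ((N.to_nat (err3N c1 c2))%:R / (256%:R * 512%:R * 256%:R ^+ 2))%:E.
Proof.
rewrite /mean_sq_error unlock.
pose g (y : outs * word * word * word) : R := let: (t, a, b, c) := y in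
  (post R 3 (mem [:: a; b; c]) (ev t) [::] - (mval (ev t) [::])%:R) ^+ 2.
rewrite (@ge0_integral_discrete _ _ _ P _ (fun w => (out w, x1 w, x2 w, x3 w))
  [seq (z, c) | z <- [seq (y, b) | y <- [seq (t, a) | t <- index_enum outs, a <- leafs],
     b <- leafs], c <- leafs] _ g)//.
- congr EFin; rewrite !big_allpairs /err3N sumNE -sum_outs mulr_suml.
  apply: eq_bigr => t _; rewrite sumNE mulr_suml; apply: eq_big_seq => a al.
  rewrite mulNE sumNE big_filter [in RHS]big_mkcond mulr_sumr mulr_suml.
  apply: eq_big_seq => b bl; rewrite mulNE sumNE big_filter.
  rewrite [in RHS]big_mkcond mulr_sumr.
  have -> (C : bool) (T : eqType) (s : seq T) (f : T -> R) :
    (if C then \sum_(i <- s) f i else 0) = \sum_(i <- s) (if C then f i else 0).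
    by case: C => //; rewrite big1.
  rewrite mulr_sumr mulr_suml; apply: eq_big_seq => c cl.
  rewrite law3 [fine _]/(p3 _) /p3 /g sqNE.
  rewrite (mprob_leaf _ _ al)// (mprob_leaf _ (c1n _ _) bl) (mprob_leaf _ (c2n _ _ _ _) cl).
  rewrite (_ : desc [::] a = true); last exact: prefix0s.
  rewrite (_ : 2 ^ size ([::] : word) = 1)%N//.
  move: (N.to_nat _) (2 ^ size _)%N (2 ^ size _)%N => v m m'.
  case: (desc _ _); last by rewrite !(mul0r, mulr0).
  case: (desc _ _); last by rewrite !(mul0r, mulr0).
  by rewrite (_ : true%:R = 1 :> R)//; field.
- apply: allpairs_uniq => //; last by move=> [? ?] [? ?] _ _ [-> ->].
  apply: allpairs_uniq => //; last by move=> [? ?] [? ?] _ _ [-> ->].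
  apply: allpairs_uniq => //; last by move=> [? ?] [? ?] _ _ [-> ->].
  exact: index_enum_uniq.
- move=> [[[t a] b] c] nin; rewrite law3 /p3.
  have [al|/mprob0 ->] := boolP (a \in leafs); last by rewrite !mul0r mulr0.
  have [bl|/mprob0 ->] := boolP (b \in leafs); last by rewrite mulr0 mul0r mulr0.
  have [cl|/mprob0 ->] := boolP (c \in leafs); last by rewrite !mulr0.
  case/negP: nin; do 3 apply: (allpairs_f pair) => //; exact: mem_index_enum.
- exact: measurable_sq_error.
- by move=> w; exact: sqr_ge0.
- by move=> [[[t a] b] c]; exact: sqr_ge0.
apply: filterS2 (good_ae hG S 3) (cond_exp_filtration hG admF 3) => w gw ->.
rewrite /g (valueE hG)//; have [->//|[p1 [y ->]]] := play3 gw.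
(* The root is already known to be 1: the error vanishes with the actual third leaf as with [x3]. *)
have mono c : post R 3 (mem [:: x1 w; x2 w; c]) (ev (out w)) [::] = 1 /\ mval (ev (out w)) [::].
  apply: post_mono p1 _ => v _ /=; rewrite !inE.
  by case/orP => ->; rewrite ?orbT.
by have [-> _] := mono y; have [-> _] := mono (x3 w).
Qed.

End Errors.

Lemma to_nat_lt (a b : N) : N.ltb a b -> (N.to_nat a < N.to_nat b)%N.
Proof. by move=> /N.ltb_lt ab; apply/ssrnat.ltP; lia. Qed.

Lemma err2N_lt : (N.to_nat (err2N step1) < N.to_nat (err2N alt1))%N.
Proof. by apply: to_nat_lt; vm_compute. Qed.

Lemma err3N_lt : (N.to_nat (err3N alt1 alt2) < N.to_nat (err3N step1 step2))%N.
Proof. by apply: to_nat_lt; vm_compute. Qed.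

(* A longest word of [B]; when [B] is the union of the branches of the explored
   nodes, this is an explored node, so that choosing it amounts to stopping. *)
Definition longest (B : {fset word}) : word :=
  head [::] [seq x <- enum_fset B | all (fun y => (size y <= size x)%N) (enum_fset B)].

Lemma longest_Bset (X : {fset word}) x0 : x0 \in X -> longest (Bset X) \in X.
Proof.
move=> x0X; have sub y : y \in X -> y \in Bset X.
  move=> yX; rewrite in_fset; apply/flatten_mapP; exists y => //.
  by apply/mapP; exists (size y); rewrite ?take_size// mem_iota /= ltnS.
have longX y : y \in Bset X -> all (fun z => (size z <= size y)%N) (enum_fset (Bset X)) ->
    y \in X.
  rewrite in_fset => /flatten_mapP[z zX /mapP[k]].
  rewrite mem_iota /= add0n ltnS => kz -> /allP/(_ z (sub z zX)).
  by rewrite size_takel// => zk; rewrite take_oversize.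
rewrite /longest; case E : [seq _ <- _ | _] => [|y s] /=; last first.
  have : y \in [seq x <- enum_fset (Bset X) |
      all (fun y => (size y <= size x)%N) (enum_fset (Bset X))] by rewrite E mem_head.
  by rewrite mem_filter => /andP[yl yB]; exact: longX.
(* A word of maximal length exists, so the filtered list cannot be empty. *)
pose m := \max_(y <- enum_fset (Bset X)) size y.
have [y yB ym] : exists2 y, y \in Bset X & size y = m.
  have : (0 < size (enum_fset (Bset X)))%N.
    have : x0 \in enum_fset (Bset X) by exact: sub.
    by case: (enum_fset (Bset X)).
  suff h (s : seq word) : (0 < size s)%N ->
      exists2 y, y \in s & size y = \max_(y <- s) size y by exact: h.
  elim: s => // a [|b s] IH _.
    by exists a; rewrite ?mem_head// big_seq1.
  have [y ys yE] := IH isT; rewrite big_cons -yE.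
  case: leqP => _; first by exists y; rewrite // inE ys orbT.
  by exists a; rewrite ?mem_head.
suff : y \in [::] by [].
rewrite -E mem_filter yB andbT; apply/allP => z zB; rewrite ym.
by apply: leq_bigmax_seq.
Qed.

(** Admissibility is demanded at every sample point, also where a match ends off the leaves; testing
    membership in [D] and falling back on an explored node ensure it. *)
Definition alt_strategy (R : realType) : strategy R := fun B D o _ =>
  let z := altsel [seq x <- leafs | x \in B] (fun x => odflt false o.[? x]) in
  if z \in D then z else longest B.

Section Comparison.
Context (R : realType) (d : measure_display) (Omega : measurableType d).
Variables (P : probability Omega R) (G : random_game Omega).
Hypothesis hG : binary_bernoulli_game P G 3.
Variable S : simulator P G.
Local Notation out := (out G).

Lemma good_le m n w : (m <= n)%N -> good S n w -> good S m w.
Proof. by move=> mn gw i z im; apply: gw; exact: leq_trans im mn. Qed.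

Lemma good_first n w : good S n.+1 w -> rmatch S 0 [::] w \in leafs.
Proof. by move=> /(_ 0%N [::] isT isT)[]. Qed.

Lemma size_play F n w : size (play S F n w) = n.
Proof. by elim: n => //= n IH; rewrite size_rcons IH. Qed.

Lemma alt_admissible : admissible S (@alt_strategy R).
Proof.
split=> [B D o z|n w n0].
  rewrite /alt_strategy; set y := (if _ then _ else _).
  have [->|yz] := eqVneq y z.
    by rewrite (_ : [set _ | _]%classic = setT)//; apply/seteqP; split.
  by rewrite (_ : [set _ | _]%classic = set0)//; apply/seteqP; split=> // u /= /eqP;
    rewrite (negbTE yz).
rewrite /chosen /choice_of /alt_strategy in_fsetU; set z := altsel _ _.
case: ifP => [->//|_]; apply/orP; right.
have : (0 < size (play S (@alt_strategy R) n w))%N by rewrite size_play.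
case E : (play S (@alt_strategy R) n w) => [//|x s] _.
by apply: (@longest_Bset _ x); rewrite in_fset E mem_head.
Qed.

Lemma decided (t : outs) x1 x2 :
  postN 3 (mem [:: x1; x2]) (bit2 x1 (ev t x1) (ev t x2)) [::] = 256%N ->
  post R 3 (mem [:: x1; x2]) (ev t) [::] = 1.
Proof.
move=> p; rewrite (@post_ext _ _ _ _ (bit2 x1 (ev t x1) (ev t x2))).
  by rewrite postE p divff ?pnatr_eq0.
move=> y /=; rewrite !inE /bit2; case: eqVneq => [->//|_] /=.
by move=> /eqP ->.
Qed.

Section StepByStepErrors.
Variable F : strategy R.
Hypothesis sF : step_by_step S F.

Lemma step_start1 w : good S 1 w ->
  start S F 1 [:: rmatch S 0 [::] w] w =
  step1 (rmatch S 0 [::] w) (ev (out w) (rmatch S 0 [::] w)).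
Proof.
move=> gw; have x1l := good_first gw; have [dc rc] := step1_check (ev (out w) (rmatch S 0 [::] w)) x1l.
apply: (step_ruleE hG (X := explored S F 1 w) (o := fun=> ev (out w) (rmatch S 0 [::] w)))
  (sF.2 1%N w isT) dc rc => x.
  by rewrite in_fset play1.
by rewrite inE => /eqP ->; exact: (value_leaf hG).
Qed.

Lemma step_start2 w : good S 2 w ->
  let x1 := rmatch S 0 [::] w in let b1 := ev (out w) x1 in
  let x2 := rmatch S 1 (step1 x1 b1) w in
  start S F 2 [:: x1; x2] w = step2 x1 b1 x2 (ev (out w) x2) \/
  post R 3 (mem [:: x1; x2]) (ev (out w)) [::] = 1.
Proof.
move=> gw x1 b1 x2; have gw1 := good_le (leqnSn 1) gw.
have x1l : x1 \in leafs := good_first gw1.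
have [x2l dx] := gw 1%N (step1 x1 b1) isT (nd_nodes _).
have [[dc rc]|p] := @step2_check x1 b1 x2 (ev (out w) x2) x1l x2l dx; last first.
  by right; exact: decided.
left; have pE : play S F 2 w = [:: x1; x2].
  by rewrite (good_playS hG sF.1 gw) play1 step_start1.
have := sF.2 2%N w isT; rewrite /chosen /explored pE => sr.
apply: (step_ruleE hG _ _ sr dc rc) => x; first by rewrite in_fset.
rewrite !inE /bit2; case: eqVneq => [->|_] /=; first by rewrite (value_leaf hG).
by move=> /eqP ->; rewrite (value_leaf hG).
Qed.

End StepByStepErrors.

(** A leaf belongs to B_X exactly when it is explored, so the strategy rebuilds the list of explored
    leaves. *)
Lemma alt_choice n xs w : {subset xs <= leafs} -> (0 < n)%N ->
  let z := altsel [seq x <- leafs | x \in xs] (ev (out w)) in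
  z \in dset xs -> start S (@alt_strategy R) n xs w = z.
Proof.
move=> xl n0 z zd.
rewrite /start eqn0Ngt n0 /choice_of /alt_strategy (gtreeE hG).
rewrite (_ : altsel _ _ = z).
  by rewrite (Dset_mem (xs := xs)) ?zd// => x; rewrite in_fset.
rewrite /z (_ : [seq x <- leafs | x \in Bset _] = [seq x <- leafs | x \in xs]).
  apply: altsel_ext => x; rewrite mem_filter => /andP[xx xL].
  rewrite (outcomeE hG) fnd_restrict. by rewrite fnd_fm xL in_fset xx.
apply: eq_in_filter => x xL.
have := @leaf_Bset [fset x in xs] x; rewrite in_fset /= size_leafs// andbT => -> //.
by move=> y; rewrite in_fset; exact: xl.
Qed.

Lemma alt_start1 w : good S 1 w ->
  start S (@alt_strategy R) 1 [:: rmatch S 0 [::] w] w =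
  alt1 (rmatch S 0 [::] w) (ev (out w) (rmatch S 0 [::] w)).
Proof.
move=> gw; have x1l := good_first gw; set x1 := rmatch S 0 [::] w in x1l *.
have fE : [seq x <- leafs | x \in [:: x1]] = [:: x1].
  rewrite (eq_filter (a2 := pred1 x1)) => [|x]; last by rewrite inE.
  by rewrite filter_pred1_uniq.
have zd := alt1_check (ev (out w) x1) x1l.
have aE : altsel [:: x1] (ev (out w)) = altsel [:: x1] (fun=> ev (out w) x1).
  by apply: altsel_ext => x; rewrite inE => /eqP ->.
rewrite alt_choice ?fE ?aE//.
  by rewrite /alt1 nd_id//; case: (dset_nodes zd).
by move=> x; rewrite inE => /eqP ->.
Qed.

Lemma alt_start2 w : good S 2 w ->
  let x1 := rmatch S 0 [::] w in let b1 := ev (out w) x1 in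
  let x2 := rmatch S 1 (alt1 x1 b1) w in
  start S (@alt_strategy R) 2 [:: x1; x2] w = alt2 x1 b1 x2 (ev (out w) x2) \/
  post R 3 (mem [:: x1; x2]) (ev (out w)) [::] = 1.
Proof.
move=> gw x1 b1 x2; have gw1 := good_le (leqnSn 1) gw.
have x1l : x1 \in leafs := good_first gw1.
have [x2l dx] := gw 1%N (alt1 x1 b1) isT (nd_nodes _).
have [zd|p] := @alt2_check x1 b1 x2 (ev (out w) x2) x1l x2l dx; last first.
  by right; exact: decided.
left; have aE : altsel [seq x <- leafs | x \in [:: x1; x2]] (ev (out w)) =
    altsel [seq x <- leafs | x \in [:: x1; x2]] (bit2 x1 b1 (ev (out w) x2)).
  apply: altsel_ext => x; rewrite mem_filter => /andP[+ _]; rewrite !inE /bit2.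
  by case: eqVneq => [->//|_] /= /eqP ->.
rewrite alt_choice ?aE//.
  by rewrite /alt2 nd_id//; case: (dset_nodes zd).
by move=> x; rewrite in_cons mem_seq1 => /orP[] /eqP ->.
Qed.

End Comparison.

Lemma lte_natdiv (R : realType) (a b : nat) (c : R) (x y : \bar R) : 0 < c ->
  x = (a%:R / c)%:E -> y = (b%:R / c)%:E -> (a < b)%N -> (x < y)%E.
Proof. by move=> c0 -> -> ab; rewrite lte_fin ltr_pM2r ?invr_gt0// ltr_nat. Qed.

Theorem mainTheorem3 (R : realType) (d : measure_display)
    (Omega : measurableType d) (P : probability Omega R)
    (G : random_game Omega) (hG : binary_bernoulli_game P G 3) :
  branching_assumption P G /\
  (forall (S : simulator P G) (F : strategy R), step_by_step S F ->
     exists F' : strategy R,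
       [/\ admissible S F',
           (mean_sq_error S F 2 < mean_sq_error S F' 2)%E &
           (mean_sq_error S F' 3 < mean_sq_error S F 3)%E]).
Proof.
split=> [|S F sF]; first exact: branching_binary hG.
have aA := alt_admissible S.
have s1n x b : step1 x b \in nodes by exact: nd_nodes.
have s2n x b y b' : step2 x b y b' \in nodes by exact: nd_nodes.
have a1n x b : alt1 x b \in nodes by exact: nd_nodes.
have a2n x b y b' : alt2 x b y b' \in nodes by exact: nd_nodes.
(* At each step both strategies have the same denominator; its positivity reduces the comparison to
   numerators. *)
have c0 n : (0 < n)%N -> 0 < 256%:R * n%:R * 256%:R ^+ 2 :> R.
  by move=> n0; rewrite !mulr_gt0 ?exprn_gt0 ?ltr0n.
have s2 := mean_sq_error2 hG sF.1 s1n (step_start1 hG sF).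
have a2 := mean_sq_error2 hG aA a1n (alt_start1 hG (S := S)).
have s3 := mean_sq_error3 hG sF.1 s1n s2n (step_start1 hG sF) (step_start2 hG sF).
have a3 := mean_sq_error3 hG aA a1n a2n (alt_start1 hG (S := S)) (alt_start2 hG (S := S)).
exists (@alt_strategy R); split=> //.
  exact: (lte_natdiv (c0 64%N isT) s2 a2 err2N_lt).
exact: (lte_natdiv (c0 512%N isT) a3 s3 err3N_lt).
Qed.
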